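(* Let $d,m$ be positive integers with $m\geqslant2$, let $1<p\leqslant2$, let $0<\varepsilon\leqslant1$, let $k\geqslant d$ be an integer, and set \[ C'\coloneqq\exp\Big(\frac{24d\ln m}{(\varepsilon^3/4)^{4d}(p-1)^d}\,k^d\Big). \] Let $n\geqslant C'$ be an integer and let $(\mathcal{V},\lambda)$ be a finite probability space. For every $v\in\mathcal{V}$ let $\boldsymbol{X}_v=\langle X^v_s:s\in\binom{[n]}{d}\rangle$ be a $(1/C')$-spreadable, $d$-dimensional random array on $[n]$ taking values in a set $\mathcal{X}_v$ with $|\mathcal{X}_v|=m$, and assume there exists $\mathcal{S}_v\subseteq\mathcal{X}_v$ with $|\mathcal{S}_v|=|\mathcal{X}_v|-1$ such that for every $a\in\mathcal{S}_v$, \[ \Big|\mathbb{P}\Big(\bigcap_{s\in\mathrm{Box}(d)}[X^v_s=a]\Big)-\prod_{s\in\mathrm{Box}(d)}\mathbb{P}([X^v_s=a])\Big|\leqslant\frac1{C'}. \] Finally, for every $v\in\mathcal{V}$ let $f_v\colon\mathcal{X}_v^{\binom{[n]}{d}}\to\mathbb{R}$ satisfy $\mathbb{E}[f_v(\boldsymbol{X}_v)]=0$ and $\|f_v(\boldsymbol{X}_v)\|_{L_p}=1$. Then there exist $G\subseteq\mathcal{V}$ with $\lambda(G)\geqslant1-\varepsilon$ and an interval $I$ of $[n]$ with $|I|=k$ such that for every $v\in G$ and every $J\subseteq I$ with $|J|\geqslant d$, \[ \mathbb{P}\big(\big|\mathbb{E}[f_v(\boldsymbol{X}_v)\,|\,\mathcal{F}_J]\big|\leqslant\varepsilon\big)\geqslant1-\varepsilon,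 \] where $\mathcal{F}_J$ is the $\sigma$-algebra generated by $\langle X^v_s:s\in\binom{J}{d}\rangle$.
   Context: $[n]=\{1,\dots,n\}$, $\binom{I}{d}$ is the set of $d$-element subsets of $I$. A $d$-dimensional random array $\boldsymbol{X}$ on $[n]$ is $\eta$-spreadable if for all $J,K\subseteq[n]$ with $|J|=|K|\geqslant d$ the laws of the subarrays $\langle X_s:s\in\binom{J}{d}\rangle$ and $\langle X_s:s\in\binom{K}{d}\rangle$ (identified via the increasing bijection $J\to K$) are at total variation distance at most $\eta$. $\mathrm{Box}(d)=\{s\in\binom{[n]}{d}:|s\cap\{2i-1,2i\}|=1\ \forall i\in[d]\}$. An interval is a set of consecutive integers. *)

(* Defs.v *)
From HB Require Import structures.
From mathcomp Require Import all_boot all_order all_algebra.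
From mathcomp Require Import all_classical all_reals all_analysis.
Set Implicit Arguments. Unset Strict Implicit. Unset Printing Implicit Defensive.
Import Order.TTheory GRing.Theory Num.Theory.
Local Open Scope ring_scope.

(* Ground set [n] = {1,...,n} is represented by 'I_n = {0,...,n-1}. *)

Definition dsub (n d : nat) := {s : {set 'I_n} | #|s| == d}.

Definition array (n d : nat) (T : finType) := {ffun dsub n d -> T}.

Definition xat (n d : nat) (T : finType) (x : array n d T) (S : {set 'I_n})
  : option T := if insub S is Some s then Some (x s) else None.

Section Prob.
Variable R : realType.

Definition is_distr (A : finType) (mu : A -> R) : Prop :=
  (forall a, 0 <= mu a) /\ \sum_(a : A) mu a = 1.

Definition prob (A : finType) (mu : A -> R) (P : pred A) : R :=
  \sum_(a | P a) mu a.

Definition expect (A : finType) (mu : A -> R) (g : A -> R) : R :=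
  \sum_(a : A) mu a * g a.

Definition Lpnorm (A : finType) (mu : A -> R) (p : R) (g : A -> R) : R :=
  (\sum_(a : A) mu a * (`|g a| `^ p)) `^ (p^-1).

(* Law of the subarray < X_{e(t)} : t in binom([j],d) > along a map
   e : 'I_j -> 'I_n (for strictly increasing e this is the subarray on the
   image J = e([j]) identified with [j] via the increasing bijection). *)
Definition sublaw (n d j : nat) (T : finType) (mu : array n d T -> R)
  (e : 'I_j -> 'I_n) (y : {ffun dsub j d -> option T}) : R :=
  \sum_(x : array n d T | [forall t : dsub j d, xat x (e @: val t) == y t]) mu x.

Definition tv_dist (A : finType) (P Q : A -> R) : R :=
  2^-1 * \sum_(a : A) `|P a - Q a|.

Definition strictly_increasing (j n : nat) (e : 'I_j -> 'I_n) : Prop :=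
  forall a b : 'I_j, (a < b)%N -> (e a < e b)%N.

(* eta-spreadability: for all J, K with |J| = |K| >= d, the laws of the
   subarrays on J and K (identified via the increasing bijection) are at
   total variation distance <= eta.  A set J with |J| = j is parametrized
   by its increasing enumeration 'I_j -> 'I_n. *)
Definition spreadable (n d : nat) (T : finType) (mu : array n d T -> R)
  (eta : R) : Prop :=
  forall (j : nat), (d <= j)%N ->
  forall e1 e2 : 'I_j -> 'I_n,
    strictly_increasing e1 -> strictly_increasing e2 ->
    tv_dist (sublaw mu e1) (sublaw mu e2) <= eta.

(* Conditional expectation of g(X) given F_J = sigma(X_s : s in binom(J,d)),
   evaluated at the outcome x (finite setting: average over the atom of x). *)
Definition agreeJ (n d : nat) (T : finType) (J : {set 'I_n})
  (x x' : array n d T) : bool :=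
  [forall s : dsub n d, (val s \subset J) ==> (x s == x' s)].

Definition condexp (n d : nat) (T : finType) (mu : array n d T -> R)
  (g : array n d T -> R) (J : {set 'I_n}) (x : array n d T) : R :=
  (\sum_(x' | agreeJ J x x') mu x' * g x') /
  (\sum_(x' | agreeJ J x x') mu x').

End Prob.

(* Box(d) = { s : |s ∩ {2i-1,2i}| = 1 for all i in [d] }; 0-indexed the
   pairs are {2i, 2i+1} for i < d, i.e. elements x with x./2 = i. *)
Definition Box (n d : nat) : {set dsub n d} :=
  [set s : dsub n d | [forall i : 'I_d,
      #|[set x in val s | (x./2 == i)%N]| == 1%N]].

Definition is_int_interval (n : nat) (I : {set 'I_n}) : Prop :=
  forall x y z : 'I_n, x \in I -> z \in I -> (x <= y)%N -> (y <= z)%N -> y \in I.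

(* Main.v *)
(* Say that [j] is bad for [v] if the conclusion fails for some [J] inside the
   [j]-th of [M] consecutive intervals of length [k]; a sign function of
   [E[f | F_J]] is then bounded by [1], depends only on that interval, and has
   correlation at least [eps ^ 2] with [f].  By repeated Cauchy-Schwarz (as for
   quasirandom hypergraphs), spreadability and box independence make the entries
   of the array nearly i.i.d., so these functions are nearly independent and
   their centered sum is subgaussian, with [L_q] norm [O(sqrt (q * number of bad
   j))] for [q = p / (p - 1)].  As [f] has [L_p] norm [1], Young's inequality
   bounds the number of bad [j] by [8 q / eps ^ 4], and averaging over [v]
   yields an interval that is bad only for a set of measure at most [eps]. *)
Require Import Defs.
From HB Require Import structures.
From mathcomp Require Import all_boot all_order all_algebra.
From mathcomp Require Import all_classical all_reals all_analysis.
From mathcomp Require Import zify ring lra.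
Set Implicit Arguments. Unset Strict Implicit. Unset Printing Implicit Defensive.
Import Order.TTheory GRing.Theory Num.Theory.
Local Open Scope ring_scope.

(** * Expectations and patterns *)

(** The box condition concerns one box and only the values in [S]. It enters as an upper bound for
    that box; matching lower bounds come from Cauchy-Schwarz itself, and the value outside [S] is
    recovered because probabilities sum to 1. Cauchy-Schwarz needs many almost equally likely copies
    of an event in which a single vertex moves. Spreadability supplies them once the vertices are
    stretched apart to leave [N] positions for each, at a cost of [1 / N]. Reaching the joint law of
    the entries takes up to [2 * d] square roots: [d] to close the sides of the full box and [d] to
    separate one entry from other constraints. So the final error is about the [4 ^ d]-th root of
    the initial one. It must still beat the number [m ^ (M * k ^ d)] of value patterns on all blocks
    together, where [M] is of order [1 / ((p - 1) * eps ^ 5)]; this is why [C'] is exponential in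
    [k ^ d]. Near independence is needed only for exponentials of a small multiple of the summands:
    a bound on the moment generating function at two points, [lam] and [- lam], already controls the
    [q]-th moment. *)

Section Expectation.
Variables (R : realType) (A : finType) (mu : A -> R).
Implicit Types g h : A -> R.

Lemma eq_expect g h : g =1 h -> expect mu g = expect mu h.
Proof. by move=> gh; apply: eq_bigr => x _; rewrite gh. Qed.

Lemma expectD g h : expect mu (fun x => g x + h x) = expect mu g + expect mu h.
Proof. by rewrite /expect -big_split; apply: eq_bigr => x _; rewrite mulrDr. Qed.

Lemma expectZ c g : expect mu (fun x => c * g x) = c * expect mu g.
Proof. by rewrite /expect big_distrr; apply: eq_bigr => x _; rewrite mulrCA. Qed.

Lemma expectN g : expect mu (fun x => - g x) = - expect mu g.
Proof. by rewrite /expect -sumrN; apply: eq_bigr => x _; rewrite mulrN. Qed.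

Lemma expectB g h : expect mu (fun x => g x - h x) = expect mu g - expect mu h.
Proof. by rewrite expectD expectN. Qed.

Lemma expect_sum (I : Type) (r : seq I) (P : pred I) (G : I -> A -> R) :
  expect mu (fun x => \sum_(i <- r | P i) G i x)
  = \sum_(i <- r | P i) expect mu (G i).
Proof.
rewrite /expect exchange_big /=; apply: eq_bigr => x _.
by rewrite big_distrr.
Qed.

Hypothesis mu_distr : is_distr mu.

Lemma expect_const c : expect mu (fun=> c) = c.
Proof. by rewrite /expect -big_distrl /= mu_distr.2 mul1r. Qed.

Lemma ler_expect g h : (forall x, g x <= h x) -> expect mu g <= expect mu h.
Proof. by move=> gh; apply: ler_sum => x _; rewrite ler_wpM2l // mu_distr.1. Qed.

Lemma expect_ge0 g : (forall x, 0 <= g x) -> 0 <= expect mu g.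
Proof. by move=> gh; apply: sumr_ge0 => x _; rewrite mulr_ge0 // mu_distr.1. Qed.

Lemma expect_ler g c : (forall x, g x <= c) -> expect mu g <= c.
Proof. by move=> gc; rewrite -[leRHS]expect_const; apply: ler_expect. Qed.

Lemma ler_norm_expect g c : (forall x, `|g x| <= c) -> `|expect mu g| <= c.
Proof.
move=> gc; have gc' x : - c <= g x <= c by rewrite -ler_norml.
rewrite ler_norml; apply/andP; split; last first.
  by apply: expect_ler => x; case/andP: (gc' x).
rewrite lerNl -expectN; apply: expect_ler => x.
by rewrite lerNl; case/andP: (gc' x).
Qed.

Lemma sqr_expect_le g : expect mu g ^+ 2 <= expect mu (fun x => g x ^+ 2).
Proof.
rewrite -subr_ge0; set e := expect mu g.
have -> : expect mu (fun x => g x ^+ 2) - e ^+ 2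
        = expect mu (fun x => (g x - e) ^+ 2).
  have E x : (g x - e) ^+ 2 = g x ^+ 2 - (2 * e) * g x + e ^+ 2 by ring.
  by rewrite (eq_expect E) expectD expectB expectZ expect_const -/e; ring.
by apply: expect_ge0 => x; apply: sqr_ge0.
Qed.

Lemma prob_expect (P : pred A) : prob mu P = expect mu (fun x => (P x)%:R).
Proof.
rewrite /prob /expect big_mkcond; apply: eq_bigr => x _.
by case: (P x); rewrite ?mulr1 ?mulr0.
Qed.

(* Expand the second moment of [\sum_t k t]: the diagonal contributes at most
   [N], and the other terms at most [N ^+ 2 * rho]. *)
Lemma avg_cauchy_schwarz (N : nat) (k : 'I_N -> A -> R) (g : A -> R)
    (z gam rho : R) :
  (0 < N)%N -> (forall x, `|g x| <= 1) -> (forall t x, `|k t x| <= 1) ->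
  (forall t, `|z - expect mu (fun x => g x * k t x)| <= gam) ->
  0 <= rho ->
  (forall t t' : 'I_N, (t < t')%N ->
    expect mu (fun x => k t x * k t' x) <= rho) ->
  `|z| <= gam + Num.sqrt (N%:R^-1 + rho).
Proof.
move=> N0 g1 k1 zk rho0 kk.
have N0' : 0 < N%:R :> R by rewrite ltr0n.
pose Y x := \sum_(t < N) k t x.
have H1 : `|N%:R * z - expect mu (fun x => g x * Y x)| <= N%:R * gam.
  have -> : expect mu (fun x => g x * Y x)
          = \sum_(t < N) expect mu (fun x => g x * k t x).
    rewrite -expect_sum; apply: eq_expect => x.
    by rewrite /Y big_distrr.
  have -> : N%:R * z = \sum_(t < N) z.
    by rewrite sumr_const card_ord mulr_natl.
  rewrite -sumrB; apply: le_trans (ler_norm_sum _ _ _) _.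
  have -> : N%:R * gam = \sum_(t < N) gam.
    by rewrite sumr_const card_ord mulr_natl.
  by apply: ler_sum => t _; apply: zk.
have H2 : expect mu (fun x => Y x ^+ 2) <= N%:R + N%:R ^+ 2 * rho.
  have -> : expect mu (fun x => Y x ^+ 2)
          = \sum_(t < N) \sum_(t' < N) expect mu (fun x => k t x * k t' x).
    transitivity (expect mu (fun x => \sum_(t < N) \sum_(t' < N) k t x * k t' x)).
      apply: eq_expect => x; rewrite expr2 /Y big_distrl /=.
      by apply: eq_bigr => t _; rewrite big_distrr.
    by rewrite expect_sum; apply: eq_bigr => t _; rewrite expect_sum.
  have -> : N%:R + N%:R ^+ 2 * rho
          = \sum_(t < N) \sum_(t' < N) ((t' == t)%:R + rho).
    transitivity (\sum_(t < N) (1 + N%:R * rho)).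
      by rewrite sumr_const card_ord -mulr_natl; ring.
    apply: eq_bigr => t _; rewrite big_split /= sumr_const card_ord mulr_natl.
    congr (_ + _); rewrite (bigD1 t) //= eqxx big1 ?addr0 // => i /negbTE ->.
    by [].
  apply: ler_sum => t _; apply: ler_sum => t' _.
  have [->|ne] := eqVneq t' t.
    apply: le_trans (_ : 1 <= _); last by rewrite lerDl.
    apply: expect_ler => x; apply: le_trans (ler_norm _) _.
    by rewrite normrM; apply: mulr_ile1.
  rewrite add0r; case: (ltngtP t t') => [lt|lt|eq].
  - exact: kk.
  - rewrite (eq_expect (h := fun x => k t' x * k t x)); first exact: kk.
    by move=> x; rewrite mulrC.
  - by case/eqP: ne; apply/val_inj.
have H3 : `|expect mu (fun x => g x * Y x)| <= N%:R * Num.sqrt (N%:R^-1 + rho).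
  have -> : N%:R * Num.sqrt (N%:R^-1 + rho) = Num.sqrt (N%:R + N%:R ^+ 2 * rho).
    have -> : N%:R + N%:R ^+ 2 * rho = N%:R ^+ 2 * (N%:R^-1 + rho).
      by field; rewrite lt0r_neq0.
    by rewrite sqrtrM ?sqr_ge0 // sqrtr_sqr gtr0_norm.
  rewrite -sqrtr_sqr; apply: ler_wsqrtr.
  apply: le_trans (sqr_expect_le _) _; apply: le_trans H2.
  apply: ler_expect => x; rewrite exprMn -[leRHS]mul1r ler_wpM2r ?sqr_ge0 //.
  by rewrite -real_normK ?num_real // expr_le1.
have H4 : `|N%:R * z| <= N%:R * (gam + Num.sqrt (N%:R^-1 + rho)).
  rewrite mulrDr; apply: le_trans (lerD H1 H3).
  by apply: le_trans (ler_normD _ _); rewrite subrK.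
by rewrite normrM gtr0_norm // ler_pM2l in H4.
Qed.

End Expectation.

(** A finite list of constraints, each prescribing the value of one entry. The vertex sets are
    unrestricted so that [move] makes sense for every map; [uniform_in] adds the size condition,
    without which [xat] is [None] and nothing matches. *)
Definition pattern (n : nat) (T : finType) := seq ({set 'I_n} * T).

Section Patterns.
Variables (n d : nat) (T : finType).
Implicit Types (w : pattern n T) (x : array n d T).

Definition matches w x : bool := all (fun sa => xat x sa.1 == Some sa.2) w.

Definition move (theta : 'I_n -> 'I_n) w : pattern n T :=
  map (fun sa : {set 'I_n} * T => (theta @: sa.1, sa.2)) w.

Definition uniform_in (U : {set 'I_n}) w : Prop :=
  forall sa, sa \in w -> #|sa.1| = d /\ sa.1 \subset U.

Definition increasing_on (U : {set 'I_n}) (theta : 'I_n -> 'I_n) : Prop :=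
  {in U &, forall u u' : 'I_n, (u < u')%N -> (theta u < theta u')%N}.

Lemma increasing_on_inj U theta : increasing_on U theta -> {in U &, injective theta}.
Proof.
move=> inc u u' uU u'U e; apply/val_inj; case: (ltngtP u u') => // lt.
  by have := inc _ _ uU u'U lt; rewrite e ltnn.
by have := inc _ _ u'U uU lt; rewrite e ltnn.
Qed.

Lemma matches_cat w1 w2 x : matches (w1 ++ w2) x = matches w1 x && matches w2 x.
Proof. exact: all_cat. Qed.

Lemma move_cat theta w1 w2 : move theta (w1 ++ w2) = move theta w1 ++ move theta w2.
Proof. exact: map_cat. Qed.

Lemma uniform_in_cat U w1 w2 :
  uniform_in U (w1 ++ w2) <-> uniform_in U w1 /\ uniform_in U w2.
Proof.
split=> [H|[H1 H2] sa]; last by rewrite mem_cat => /orP[/H1|/H2].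
by split=> sa sw; apply: H; rewrite mem_cat sw ?orbT.
Qed.

Lemma uniform_in_move U theta w :
  increasing_on U theta -> uniform_in U w -> uniform_in (theta @: U) (move theta w).
Proof.
move=> inc H _ /mapP[sa sw ->] /=; have [c sU] := H _ sw.
split; last exact: imsetS.
rewrite card_in_imset // => u u' /(fintype.subsetP sU) uU /(fintype.subsetP sU) u'U.
exact: (increasing_on_inj inc).
Qed.

Lemma uniform_in_sub (U U' : {set 'I_n}) w :
  U \subset U' -> uniform_in U w -> uniform_in U' w.
Proof. by move=> UU' H sa /H [c s]; split => //; apply: fintype.subset_trans UU'. Qed.

End Patterns.

Lemma enum_val_increasing n (U : {set 'I_n}) :
  strictly_increasing (fun a : 'I_#|U| => enum_val a).
Proof.
move=> a b ab.
have so : sorted ltn [seq val i | i <- enum U].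
  have -> : enum U = [seq x <- enum 'I_n | x \in U] by rewrite enumT.
  rewrite sorted_map; apply: sorted_filter.
    by move=> x y z; apply: ltn_trans.
  by rewrite -sorted_map val_enum_ord iota_ltn_sorted.
have x0 : 'I_n by exact: (enum_val a).
have sz : size [seq val i | i <- enum U] = #|U| by rewrite size_map -cardE.
have := sorted_ltn_nth ltn_trans 0%N so.
move=> /(_ a b); rewrite !inE sz !ltn_ord => /(_ isT isT ab).
by rewrite !(nth_map x0) -?cardE ?ltn_ord // -!enum_val_nth.
Qed.

(** Both events are the same event on arrays indexed by ['I_#|U|], read along two increasing
    enumerations: that of [U] and its composition with [theta]. The factor 2 arises because the
    difference is bounded by the whole l1 distance, which is twice [tv_dist]. *)
Lemma spread_move (R : realType) (n d : nat) (T : finType)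
    (mu : array n d T -> R) (eta : R) (U : {set 'I_n}) (theta : 'I_n -> 'I_n)
    (w : pattern n T) :
  is_distr mu -> 0 <= eta -> spreadable mu eta ->
  uniform_in d U w -> increasing_on U theta ->
  `|prob mu (matches w) - prob mu (matches (move theta w))| <= 2 * eta.
Proof.
move=> mu_distr eta0 spr wU inc.
(* The empty pattern allows [#|U| < d], outside the range of [spreadable]; any constraint forces
   [d <= #|U|]. *)
case: w wU => [|sa0 w0]; first by rewrite subrr normr0 mulr_ge0.
set w := sa0 :: w0 => wU.
have dU : (d <= #|U|)%N.
  by have [<- /subset_leq_card] := wU sa0 (mem_head _ _).
pose e1 : 'I_#|U| -> 'I_n := fun a => enum_val a.
pose e2 : 'I_#|U| -> 'I_n := fun a => theta (e1 a).
have i1 : strictly_increasing e1 := @enum_val_increasing n U.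
have i2 : strictly_increasing e2.
  by move=> a b ab; apply: inc; rewrite ?enum_valP //; apply: i1.
have := spr _ dU e1 e2 i1 i2.
pose c (y : {ffun dsub #|U| d -> option T}) :=
  all (fun sa : {set 'I_n} * T =>
    [forall t : dsub #|U| d, (e1 @: val t == sa.1) ==> (y t == Some sa.2)]) w.
have ex sa : sa \in w -> exists t : dsub #|U| d, e1 @: val t = sa.1.
  move=> sw; have [cs sU] := wU _ sw.
  have im : e1 @: (e1 @^-1: sa.1) = sa.1.
    apply/setP => u; apply/imsetP/idP => [[a]|us]; first by rewrite inE => h ->.
    have uU := fintype.subsetP sU _ us.
    by exists (enum_rank_in uU u); rewrite ?inE /e1 enum_rankK_in.
  have ct : #|e1 @^-1: sa.1| == d.
    by rewrite -cs -[in X in _ == X]im card_imset //; apply: enum_val_inj.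
  by exists (exist (fun s : {set 'I_#|U|} => is_true (#|s| == d)) _ ct).
pose sub (e : 'I_#|U| -> 'I_n) (x : array n d T) :
  {ffun dsub #|U| d -> option T} := [ffun t : dsub #|U| d => xat x (e @: val t)].
have P1 x : matches w x = c (sub e1 x).
  apply: eq_in_all => sa sw; apply/idP/forallP.
    by move=> h t; apply/implyP => /eqP tE; rewrite ffunE tE.
  by move=> h; have [t tE] := ex _ sw; move: (h t); rewrite tE eqxx ffunE tE.
have P2 x : matches (move theta w) x = c (sub e2 x).
  rewrite /matches all_map; apply: eq_in_all => sa sw /=.
  have e2E (t : dsub #|U| d) : e2 @: val t = theta @: (e1 @: val t).
    by rewrite -(imset_comp theta e1).
  apply/idP/forallP.
    by move=> h t; apply/implyP => /eqP tE; rewrite ffunE e2E tE.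
  by move=> h; have [t tE] := ex _ sw; move: (h t); rewrite tE eqxx ffunE e2E tE.
have S (e : 'I_#|U| -> 'I_n) (w' : pattern n T) :
    (forall x, matches w' x = c (sub e x)) ->
    prob mu (matches w') = \sum_(y | c y) sublaw mu e y.
  move=> H; rewrite /prob.
  rewrite (partition_big (sub e) c) /=; last first.
    by move=> x; rewrite H.
  apply: eq_bigr => y cy; apply: eq_bigl => x; rewrite H.
  apply/andP/forallP => [[_ /eqP <-] t|h]; first by rewrite ffunE.
  have E : sub e x = y.
    by apply/ffunP => t; rewrite ffunE; apply/eqP.
  by rewrite E cy.
rewrite (S e1 w P1) (S e2 _ P2) -sumrB /tv_dist => tv.
apply: le_trans (ler_norm_sum _ _ _) _.
rewrite ler_pdivrMl // in tv; apply: le_trans tv.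
by rewrite [leRHS](bigID c) /= lerDl sumr_ge0.
Qed.

(** * Boxes and increasing maps *)

Section Blow.
Variables (n N : nat) (U : {set 'I_n}) (v : 'I_n).
Hypothesis room : (#|U| * N <= n)%N.

Definition rank (u : 'I_n) : nat := #|[set x in U | (x < u)%N]|.

(* Spreads [U] out to multiples of [N], and shifts [v] by [t < N] inside the
   gap that follows it. *)
Definition blow (t : nat) (u : 'I_n) : 'I_n :=
  insubd u (N * rank u + (u == v) * t)%N.

Lemma rank_lt (u u' : 'I_n) : u \in U -> (u < u')%N -> (rank u < rank u')%N.
Proof.
move=> uU uu'; apply: proper_card; apply/properP; split.
  apply/fintype.subsetP => x; rewrite !inE => /andP[-> xu] /=.
  exact: ltn_trans uu'.
by exists u; rewrite !inE ?uU //= ltnn.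
Qed.

Lemma rank_bound u : u \in U -> (rank u < #|U|)%N.
Proof.
move=> uU; apply: proper_card; apply/properP; split.
  by apply/fintype.subsetP => x; rewrite !inE => /andP[->].
by exists u => //; rewrite !inE ltnn andbF.
Qed.

Lemma blowE t u : u \in U -> (t < N)%N ->
  blow t u = (N * rank u + (u == v) * t)%N :> nat.
Proof.
move=> uU tN; rewrite /blow val_insubd.
have -> // : (N * rank u + (u == v) * t < n)%N.
have := rank_bound uU; move: room; case: (u == v); nia.
Qed.

Lemma blow_lt t t' (u u' : 'I_n) : u \in U -> u' \in U -> (t < N)%N -> (t' < N)%N ->
  (u < u')%N -> (blow t u < blow t' u')%N.
Proof.
move=> uU u'U tN t'N uu'; rewrite !blowE //.
have := rank_lt uU uu'; case: (u == v); case: (u' == v); nia.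
Qed.

Lemma blow_increasing t : (t < N)%N -> increasing_on U (blow t).
Proof. by move=> tN u u' uU u'U; apply: blow_lt. Qed.

Lemma blow_fix t t' u : u != v -> blow t u = blow t' u.
Proof. by move=> /negbTE uv; rewrite /blow uv. Qed.

Lemma blow_shift t t' : v \in U -> (t < t')%N -> (t' < N)%N ->
  (blow t v < blow t' v)%N.
Proof.
by move=> vU tt' t'N; rewrite !blowE ?(ltn_trans tt') // eqxx; nia.
Qed.

End Blow.

Section Configurations.
Variables (n d : nat).
Implicit Types (D : {set 'I_d}) (v : 'I_d -> 'I_n).

(* A combinatorial box with sides [{v0 i, v1 i}], degenerate for [i \notin D]. *)
Definition config D v0 v1 : Prop :=
  [/\ forall i, i \in D -> (v0 i < v1 i)%N,
      forall i, i \notin D -> v1 i = v0 i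
    & forall i j : 'I_d, (i < j)%N -> (v1 i < v0 j)%N].

Definition corner v0 v1 (om : {ffun 'I_d -> bool}) : {set 'I_n} :=
  [set (if om i then v1 i else v0 i) | i : 'I_d].

Definition box (T : finType) v0 v1 (a : T) : pattern n T :=
  [seq (corner v0 v1 om, a) | om <- enum {ffun 'I_d -> bool}].

Section Config.
Variables (D : {set 'I_d}) (v0 v1 : 'I_d -> 'I_n).
Hypothesis cf : config D v0 v1.

Let vt (b : bool) i := if b then v1 i else v0 i.

Lemma config_le i : (v0 i <= v1 i)%N.
Proof.
case: cf => c1 c2 _; case: (boolP (i \in D)) => [/c1/ltnW|/c2 ->] //.
Qed.

Lemma config_lt b b' (i j : 'I_d) : (i < j)%N -> (vt b i < vt b' j)%N.
Proof.
case: cf => _ _ c3 /c3 lt.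
have := config_le i; have := config_le j; rewrite /vt.
by case: b; case: b'; lia.
Qed.

Lemma config_inj b b' i j : vt b i = vt b' j -> i = j.
Proof.
move=> e; apply/val_inj; case: (ltngtP i j) => // lt.
  by have := config_lt b b' lt; rewrite e ltnn.
by have := config_lt b' b lt; rewrite e ltnn.
Qed.

Lemma card_corner om : #|corner v0 v1 om| = d.
Proof.
rewrite card_imset ?card_ord // => i j.
exact: (@config_inj (om i) (om j)).
Qed.

Lemma box_uniform (T : finType) (a : T) (U : {set 'I_n}) :
  (forall i, v0 i \in U /\ v1 i \in U) -> uniform_in d U (box v0 v1 a).
Proof.
move=> vU sa /mapP[om _ ->] /=; split; first exact: card_corner.
by apply/fintype.subsetP => _ /imsetP[i _ ->]; have [] := vU i; case: (om i).
Qed.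

Lemma config_move (U : {set 'I_n}) theta :
  (forall i, v0 i \in U /\ v1 i \in U) -> increasing_on U theta ->
  config D (theta \o v0) (theta \o v1).
Proof.
case: cf => c1 c2 c3 vU inc; have v0U i : v0 i \in U by case: (vU i).
have v1U i : v1 i \in U by case: (vU i).
by split=> [i /c1|i /c2 /= ->|i j /c3] //=; apply: inc.
Qed.

End Config.

Lemma matches_box (T : finType) v0 v1 (a : T) (x : array n d T) :
  matches (box v0 v1 a) x = [forall om, xat x (corner v0 v1 om) == Some a].
Proof.
apply/allP/forallP => [h om|h sa /mapP[om _ ->]]; last exact: h.
by have := h (corner v0 v1 om, a); apply; apply/mapP; exists om; rewrite ?mem_enum.
Qed.

Lemma move_box (T : finType) v0 v1 (a : T) theta :
  move theta (box v0 v1 a) = box (theta \o v0) (theta \o v1) a.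
Proof.
rewrite /move /box -map_comp; apply: eq_map => om /=; congr (_, _).
by rewrite /corner -imset_comp; apply: eq_imset => i /=; case: (om i).
Qed.

(** At [j] a corner of the joined box picks the vertex of one of the two boxes, and is therefore a
    corner of that box. Hence the product of the indicators of two shifted boxes is again a box
    indicator, which is what lets Cauchy-Schwarz be iterated. *)
Lemma matches_box_double (T : finType) (a : T) (j : 'I_d) al0 al1 be0 be1
    (x : array n d T) :
  al1 j = al0 j -> be1 j = be0 j ->
  (forall i, i != j -> al0 i = be0 i) -> (forall i, i != j -> al1 i = be1 i) ->
  matches (box al0 (fun i => if i == j then be0 j else al1 i) a) x
  = matches (box al0 al1 a) x && matches (box be0 be1 a) x.
Proof.
move=> aj bj ab0 ab1; rewrite !matches_box.
set ga1 := (fun i : 'I_d => if i == j then _ else _).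
have C (om : {ffun 'I_d -> bool}) :
    corner al0 ga1 om = if om j then corner be0 be1 om else corner al0 al1 om.
  rewrite /corner /ga1; case e: (om j); apply: eq_imset => i;
    have [->|ne] := eqVneq i j; rewrite ?e ?bj ?aj //.
  by rewrite ab0 // ab1.
pose upd (om : {ffun 'I_d -> bool}) b := [ffun i => if i == j then b else om i].
have updA om b : corner al0 al1 (upd om b) = corner al0 al1 om.
  by apply: eq_imset => i; rewrite ffunE; have [->|//] := eqVneq i j;
    case: b; case: (om j); rewrite ?aj.
have updB om b : corner be0 be1 (upd om b) = corner be0 be1 om.
  by apply: eq_imset => i; rewrite ffunE; have [->|//] := eqVneq i j;
    case: b; case: (om j); rewrite ?bj.
apply/forallP/andP => [h|[/forallP ha /forallP hb] om]; last first.
  by rewrite C; case: ifP.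
split; apply/forallP => om.
  by have := h (upd om false); rewrite C ffunE eqxx updA.
by have := h (upd om true); rewrite C ffunE eqxx updB.
Qed.

(** [blow] reserves [N] positions for each vertex of [U], so two shifts of [v0 j] stay between the
    images of its neighbours and can serve as the two ends of side [j]. *)
Lemma config_double (U : {set 'I_n}) (N : nat) D v0 v1 j t t' :
  (#|U| * N <= n)%N -> config D v0 v1 -> (forall i, v0 i \in U /\ v1 i \in U) ->
  j \notin D -> (t < t')%N -> (t' < N)%N ->
  config (j |: D) (blow N U (v0 j) t \o v0)
    (fun i => if i == j then blow N U (v0 j) t' (v0 j)
              else blow N U (v0 j) t (v1 i)).
Proof.
move=> room [c1 c2 c3] vU jD tt' t'N; have tN := ltn_trans tt' t'N.
have [v0U v1U] : (forall i, v0 i \in U) /\ (forall i, v1 i \in U).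
  by split=> i; case: (vU i).
split=> [i|i|i i'] /=.
- rewrite !inE; have [->|ne] /= := eqVneq i j; first by move=> _; apply: blow_shift.
  by move=> /c1 lt; apply: blow_lt.
- by rewrite !inE negb_or => /andP[/negbTE -> /c2 ->].
- move=> lt; have [E|ne] := eqVneq i j; last by apply: blow_lt => //; apply: c3.
  by rewrite -E; apply: blow_lt => //; rewrite -(c2 i) ?E //; rewrite -E; apply: c3.
Qed.

(** Sending each vertex to its counterpart is well defined, since coincidences [v0 i = v1 i] occur
    only off [D], where the targets coincide too. Combined with [spread_move], this makes box
    probabilities depend only on [D], up to [2 * eta]. *)
Lemma config_transport D v0 v1 v0' v1' :
  config D v0 v1 -> config D v0' v1' ->
  exists theta (U : {set 'I_n}), [/\ forall i, v0 i \in U /\ v1 i \in U,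
    increasing_on U theta, theta \o v0 =1 v0' & theta \o v1 =1 v1'].
Proof.
move=> cf cf'; have [c1 c2 c3] := cf; have [c1' c2' c3'] := cf'.
pose theta u := if [pick i | v0 i == u] is Some i then v0' i else
  if [pick i | v1 i == u] is Some i then v1' i else u.
have th0 i : theta (v0 i) = v0' i.
  rewrite /theta; case: pickP => [k /eqP|/(_ i)]; last by rewrite eqxx.
  by move=> /(@config_inj _ _ _ cf false false) ->.
have th1 i : theta (v1 i) = v1' i.
  rewrite /theta; case: pickP => [k /eqP e|_].
    have ki := @config_inj _ _ _ cf false true _ _ e; rewrite ki.
    case: (boolP (i \in D)) => [/c1|/c2' //].
    by rewrite -ki e ki ltnn.
  case: pickP => [k /eqP|/(_ i)]; last by rewrite eqxx.
  by move=> /(@config_inj _ _ _ cf true true) ->.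
exists theta, ([set v0 i | i : 'I_d] :|: [set v1 i | i : 'I_d]); split=> //.
  by move=> i; rewrite !inE !imset_f ?orbT.
pose vt (b : bool) i := if b then v1 i else v0 i.
pose vt' (b : bool) i := if b then v1' i else v0' i.
have thE b i : theta (vt b i) = vt' b i by case: b.
have hU u : u \in [set v0 i | i : 'I_d] :|: [set v1 i | i : 'I_d] ->
    exists b i, u = vt b i.
  by rewrite inE => /orP[] /imsetP[i _ ->]; [exists false, i|exists true, i].
move=> u u' /hU[b [i ->]] /hU[b' [i' ->]]; rewrite !thE.
case: (ltngtP i i') => [lt _|lt|/val_inj <-].
- exact: (config_lt cf').
- by have := config_lt cf b' b lt; rewrite -/(vt b' i') -/(vt b i); lia.
- case: b; case: b'; rewrite /vt /vt' /= ?ltnn //.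
    by have := config_le cf i; lia.
  by case: (boolP (i \in D)) => [/c1' //|/c2 ->]; rewrite ltnn.
Qed.

End Configurations.

(** * The counting lemma *)

Lemma matches_move_filter n d (T : finType) (c : pred ({set 'I_n} * T)) theta
    (w : pattern n T) (x : array n d T) :
  matches (move theta w) x
  = matches (move theta [seq sa <- w | c sa]) x
    && matches (move theta [seq sa <- w | ~~ c sa]) x.
Proof.
elim: w => //= sa w; rewrite /matches /= => ->.
by case: (c sa) => /=; [rewrite andbA|rewrite andbCA].
Qed.

(** As [q <= 1], squaring at most doubles the loss [l]; if [q < l], the left side is negative
    because [q ^+ 2 <= q]. This undoes a square root without taking a root of the error. *)
Lemma sqr_le_of_sub (R : realType) (q l s : R) :
  0 <= q -> q <= 1 -> 0 <= l -> 0 <= s -> q - l <= s -> q ^+ 2 - 2 * l <= s ^+ 2.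
Proof.
move=> q0 q1 l0 s0 qls.
have lq : 0 <= l * (1 - q) by rewrite mulr_ge0 // subr_ge0.
case: (leP 0 (q - l)) => ql.
  have : (q - l) ^+ 2 <= s ^+ 2 by rewrite ler_sqr ?nnegrE.
  by have := sqr_ge0 l; nra.
have : q ^+ 2 <= q by rewrite expr2 ler_piMl.
by have := sqr_ge0 s; lra.
Qed.

Section Counting.
Variables (R : realType) (n d : nat) (T : finType) (mu : array n d T -> R).
Variables (eta : R) (B N : nat) (a : T) (p z : R).
Hypothesis mu_distr : is_distr mu.
Hypothesis eta0 : 0 <= eta.
Hypothesis spr : spreadable mu eta.
Hypothesis N0 : (0 < N)%N.
Hypothesis room : (B * N <= n)%N.
Hypothesis dB : (d + d <= B)%N.
Hypothesis p01 : 0 <= p <= 1.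

Let Pr (w : pattern n T) := prob mu (matches w).

Hypothesis Pr_single : forall s : {set 'I_n}, #|s| = d ->
  `|Pr [:: (s, a)] - p| <= 2 * eta.

Variables c0 c1 : 'I_d -> 'I_n.
Hypothesis cf_full : config [set: 'I_d] c0 c1.
Hypothesis Pr_full :
  Pr (box c0 c1 a) <= p ^+ (2 ^ d) + 2 ^+ d * (2 * eta) + eta.

Let nu : R := N%:R^-1.

(* Each of the [2 * d] Cauchy-Schwarz steps takes a square root, so the errors
   are tracked as powers of a number [z] whose [4 ^ d]-th power dominates the
   initial error. *)
Hypothesis z01 : 0 <= z <= 1.
Hypothesis z_dom : 2 ^+ (d + 2) * (2 * eta + nu) <= z ^+ (2 ^ (2 * d)).

Let err (k : nat) : R := 16 * z ^+ (2 ^ (2 * d - k)).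

Let Pr01 w : 0 <= Pr w <= 1.
Proof.
rewrite /Pr prob_expect; apply/andP; split.
  by apply: expect_ge0 => // x; rewrite ler0n.
by apply: expect_ler => // x; rewrite lern1 leq_b1.
Qed.

Let nu_ge0 : 0 <= nu. Proof. by rewrite invr_ge0 ler0n. Qed.

Let one_le_pow2 k : 1 <= 2 ^+ k :> R.
Proof. by apply: exprn_ege1; rewrite ler1n. Qed.

Let err_ge0 k : 0 <= err k.
Proof. by rewrite mulr_ge0 // exprn_ge0 //; case/andP: z01. Qed.

Let small_le k : 2 ^+ (d + 2) * (2 * eta + nu) <= z ^+ (2 ^ (2 * d - k)).
Proof.
apply: le_trans z_dom _; case/andP: z01 => z0 z1.
by apply: ler_wiXn2l => //; rewrite leq_exp2l // leq_subr.
Qed.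

Let err_mono k k' : (k <= k')%N -> err k <= err k'.
Proof.
move=> kk; case/andP: z01 => z0 z1; rewrite ler_pM2l // ler_wiXn2l //.
by rewrite leq_exp2l // leq_sub2l.
Qed.

Let base_le k : 4 * (2 * eta + nu) <= z ^+ (2 ^ (2 * d - k)).
Proof.
apply: le_trans (small_le k); rewrite ler_wpM2r ?addr_ge0 ?mulr_ge0 //.
by rewrite exprD -[leLHS]mul1r (_ : 2 ^+ 2 = 4) ?ler_wpM2r //; ring.
Qed.

(** With [err k = 16 * y ^+ 2] and [err k.+1 = 16 * y], the radicand is at most
    [y ^+ 2 + 48 * y ^+ 2], so the root is at most [7 * y], and the rest of [16 * y] absorbs the
    [eta] term. The factor 3 is what [box_counting] produces. *)
Let err_step k : (k < 2 * d)%N ->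
  2 * (2 * eta) + Num.sqrt (nu + 3 * err k) <= err k.+1.
Proof.
move=> kd; set y := z ^+ (2 ^ (2 * d - k.+1)).
have y0 : 0 <= y by rewrite exprn_ge0 //; case/andP: z01.
have Ek : err k = 16 * y ^+ 2.
  by rewrite /err /y -exprM -expnSr subnSK.
have b1 := base_le k.+1; rewrite -/y in b1.
have b2 := base_le k.
rewrite (_ : z ^+ (2 ^ (2 * d - k)) = y ^+ 2) in b2; last first.
  by rewrite /y -exprM -expnSr subnSK.
have -> : err k.+1 = 16 * y by [].
have S : Num.sqrt (nu + 3 * err k) <= 7 * y.
  rewrite -[leRHS]ger0_norm ?mulr_ge0 // -sqrtr_sqr; apply: ler_wsqrtr.
  rewrite Ek; move: eta0 => h; nra.
by move: nu_ge0; lra.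
Qed.

Lemma Pr_move w U theta : uniform_in d U w -> increasing_on U theta ->
  `|Pr w - Pr (move theta w)| <= 2 * eta.
Proof. exact: spread_move. Qed.

Lemma Pr_config D (v0 v1 v0' v1' : 'I_d -> 'I_n) :
  config D v0 v1 -> config D v0' v1' ->
  `|Pr (box v0 v1 a) - Pr (box v0' v1' a)| <= 2 * eta.
Proof.
move=> cf cf'; have [th [U [vU inc e0 e1]]] := config_transport cf cf'.
have := Pr_move (box_uniform (a := a) cf vU) inc.
by rewrite move_box (boolp.funext e0) (boolp.funext e1).
Qed.

(** The averaged Cauchy-Schwarz inequality with [g = 1]: shifting [v0 j] gives [N] boxes of nearly
    the same probability, and two of them hold together exactly when the box with side [j] opened
    does. *)
Lemma Pr_box_double D (v0 v1 : 'I_d -> 'I_n) (j : 'I_d) (rho : R) :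
  config D v0 v1 -> j \notin D -> 0 <= rho ->
  (forall v0' v1', config (j |: D) v0' v1' -> Pr (box v0' v1' a) <= rho) ->
  Pr (box v0 v1 a) <= 2 * eta + Num.sqrt (nu + rho).
Proof.
move=> cf jD rho0 H.
pose U := [set v0 i | i : 'I_d] :|: [set v1 i | i : 'I_d].
have vU i : v0 i \in U /\ v1 i \in U by rewrite !inE !imset_f ?orbT.
have roomU : (#|U| * N <= n)%N.
  apply: leq_trans room; rewrite leq_mul2r; apply/orP; right.
  apply: leq_trans dB; apply: leq_trans (leq_card_setU _ _) _.
  by apply: leq_add; apply: leq_trans (leq_imset_card _ _) _; rewrite card_ord.
pose psi t := blow N U (v0 j) t.
pose w t := box (psi t \o v0) (psi t \o v1) a.
have le := ler_norm (Pr (box v0 v1 a)); apply: le_trans le _.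
apply: (@avg_cauchy_schwarz _ _ mu mu_distr N
  (fun t x => (matches (w t) x)%:R) (fun=> 1)) => //.
- by move=> x; rewrite normr1.
- by move=> t x; rewrite ger0_norm ?ler0n // lern1 leq_b1.
- move=> t; rewrite (@eq_expect _ _ mu _ (fun x => (matches (w t) x)%:R)); last first.
    by move=> x; rewrite mul1r.
  rewrite -prob_expect -/(Pr _) /w -move_box; apply: (Pr_move (U := U)).
    exact: (box_uniform cf).
  exact: blow_increasing.
- move=> t t' tt'; pose v1' i := if i == j then psi t' (v0 j) else psi t (v1 i).
  rewrite (@eq_expect _ _ mu _ (fun x => (matches (box (psi t \o v0) v1' a) x)%:R)).
    rewrite -prob_expect; apply: H.
    exact: (config_double roomU cf vU jD tt' (ltn_ord t')).
  move=> x; rewrite /w /v1' -natrM mulnb; congr (_%:R).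
  have v1j : v1 j = v0 j by case: cf => _ ->.
  have ne b i : i != j -> (if b then v1 i else v0 i) != v0 j.
    move=> ij; apply/eqP => e; case/eqP: ij.
    exact: (@config_inj _ _ _ _ _ cf b false).
  rewrite -(matches_box_double a (j := j)) //=; rewrite ?v1j //.
    by move=> i ij; apply: blow_fix; apply: (ne false).
  by move=> i ij; apply: blow_fix; apply: (ne true).
Qed.

Let pX k : 0 <= p ^+ k <= 1.
Proof. by case/andP: p01 => p0 p1; rewrite exprn_ge0 // exprn_ile1. Qed.

(** Induction down from the full box, with [k] the number of sides already closed. Closing a side
    takes a square root, which halves the exponent [2 ^ #|D|.+1] of [p] and moves the error from
    [err k] to [err k.+1]. *)
Lemma Pr_box_upper k (D : {set 'I_d}) (v0 v1 : 'I_d -> 'I_n) :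
  (#|D| + k = d)%N -> config D v0 v1 ->
  Pr (box v0 v1 a) <= p ^+ (2 ^ #|D|) + err k.
Proof.
elim: k D v0 v1 => [|k IH] D v0 v1 Dk cf.
  have DT : D = [set: 'I_d].
    apply/eqP; rewrite eqEcard finset.subsetT cardsT card_ord.
    by move: Dk; rewrite addn0 => ->; rewrite leqnn.
  rewrite DT in cf Dk *; have := Pr_config cf cf_full.
  rewrite cardsT card_ord ler_norml => /andP[_ h].
  have S := small_le 0; rewrite exprD (_ : 2 ^+ 2 = 4) in S; last by ring.
  have e0 := err_ge0 0; have P2 := one_le_pow2 d; have F := Pr_full.
  move: nu_ge0 eta0 h F; rewrite /err; set X := z ^+ _ in S e0 *.
  set Y := 2 ^+ d in S P2 *; move: (Pr _) (Pr _) => A1 A2 => n0 h0 h F.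
  by nra.
have [j jD] : exists j, j \notin D.
  apply/existsP; rewrite -negb_forall; apply/negP => /forallP h.
  have : D = [set: 'I_d] by apply/setP => j; rewrite h inE.
  move=> DT; move: Dk => /eqP.
  by rewrite DT cardsT card_ord -[X in _ == X]addn0 eqn_add2l.
have Dk' : (#|j |: D| + k = d)%N by rewrite cardsU1 jD add1n addSn -addnS.
have rho0 : 0 <= p ^+ (2 ^ #|j |: D|) + err k.
  by rewrite addr_ge0 //; case/andP: (pX (2 ^ #|j |: D|)).
have := Pr_box_double cf jD rho0 (fun v0' v1' => IH _ v0' v1' Dk').
move=> h; apply: le_trans h _.
have st : (k < 2 * d)%N.
  have := leq_addl #|D| k.+1; rewrite Dk => kd.
  exact: leq_trans kd (leq_pmull _ _).
have := err_step st.
set s := Num.sqrt (nu + 3 * err k) => hs.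
have -> : p ^+ (2 ^ #|j |: D|) = (p ^+ (2 ^ #|D|)) ^+ 2.
  by rewrite -exprM -expnSr cardsU1 jD.
set q := p ^+ (2 ^ #|D|); have /andP[q0 q1] : 0 <= q <= 1 by apply: pX.
have s0 : 0 <= s by apply: sqrtr_ge0.
have s2 : s ^+ 2 = nu + 3 * err k.
  by rewrite sqr_sqrtr // addr_ge0 // mulr_ge0.
have : Num.sqrt (nu + (q ^+ 2 + err k)) <= q + s.
  rewrite -[leRHS]ger0_norm ?addr_ge0 // -sqrtr_sqr; apply: ler_wsqrtr.
  by have := err_ge0 k; nra.
by move: eta0; lra.
Qed.

(** Induction up from a single entry: if opening a side made the box too unlikely, Cauchy-Schwarz
    would make the closed box too unlikely as well. Solving for the opened box squares rather than
    takes roots, so the error stays linear; its coefficient obeys [x -> 2 * x + 3] from 1, whose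
    solution is [2 ^+ (k + 2) - 3]. *)
Lemma Pr_box_lower k (D : {set 'I_d}) (v0 v1 : 'I_d -> 'I_n) :
  #|D| = k -> config D v0 v1 ->
  p ^+ (2 ^ k) - (2 ^+ (k + 2) - 3) * (2 * eta + nu) <= Pr (box v0 v1 a).
Proof.
elim: k D v0 v1 => [|k IH] D v0 v1 Dk cf.
  have D0 : D = finset.set0 by apply/eqP; rewrite -cards_eq0 Dk.
  have vE : v1 = v0.
    by apply: boolp.funext => i; case: cf => _ c2 _; apply: c2; rewrite D0 inE.
  have := Pr_single (card_corner cf [ffun=> false]).
  rewrite (_ : Pr (box v0 v1 a) = Pr [:: (corner v0 v1 [ffun=> false], a)]).
    rewrite ler_norml => /andP[h _].
    rewrite expn0 expr1 add0n (_ : 2 ^+ 2 - 3 = 1); last by ring.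
    by move: nu_ge0; lra.
  apply: eq_bigl => x; rewrite matches_box /matches /= andbT.
  have E om : corner v0 v1 om = corner v0 v1 [ffun=> false].
    by apply: eq_imset => i; rewrite vE !if_same.
  by apply/forallP/idP => [/(_ [ffun=> false])|h om]; rewrite ?E.
have [j jD] : exists j, j \in D by apply/card_gt0P; rewrite Dk.
pose v1' i := if i == j then v0 j else v1 i.
have cf' : config (D :\ j) v0 v1'.
  case: (cf) => c1' c2' c3'; split=> [i|i|i i']; rewrite /v1' ?inE.
  - by case/andP => /negbTE -> /c1'.
  - by have [-> //|_ /=] := eqVneq i j; apply: c2'.
  - have [->|_] := eqVneq i j; last exact: c3'.
    by move=> /c3'; apply: leq_ltn_trans (config_le cf j).
have Dk' : #|D :\ j| = k by apply: succn_inj; rewrite -Dk (cardsD1 j D) jD.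
have h1 := IH _ _ _ Dk' cf'.
have /andP[P0 _] := Pr01 (box v0 v1 a).
have rho0 : 0 <= Pr (box v0 v1 a) + 2 * eta by rewrite addr_ge0 ?mulr_ge0.
have jD' : j \notin D :\ j by rewrite !inE eqxx.
have h2 : Pr (box v0 v1' a)
    <= 2 * eta + Num.sqrt (nu + (Pr (box v0 v1 a) + 2 * eta)).
  apply: (Pr_box_double cf' jD' rho0) => w0 w1; rewrite finset.setD1K // => cfw.
  by have := Pr_config cfw cf; rewrite ler_norml => /andP[_]; lra.
move: h1 h2; set q := p ^+ (2 ^ k); set L := 2 ^+ (k + 2) => h1 h2.
have -> : p ^+ (2 ^ k.+1) = q ^+ 2 by rewrite -exprM -expnSr.
have -> : 2 ^+ (k.+1 + 2) = 2 * L by rewrite addSn exprS.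
have /andP[q0 q1] : 0 <= q <= 1 by apply: pX.
have L4 : 4 <= L.
  by rewrite /L exprD (_ : 2 ^+ 2 = 4) ?ler_peMl //; ring.
move: h2; set s := Num.sqrt _ => h2.
have s0 : 0 <= s by apply: sqrtr_ge0.
have s2 : s ^+ 2 = nu + (Pr (box v0 v1 a) + 2 * eta).
  by rewrite sqr_sqrtr // addr_ge0.
set l := (L - 3) * (2 * eta + nu) + 2 * eta.
have l0 : 0 <= l.
  by apply: addr_ge0; [apply: mulr_ge0|]; move: nu_ge0 eta0; lra.
have qls : q - l <= s by rewrite /l; lra.
have := sqr_le_of_sub q0 q1 l0 s0 qls; rewrite s2 /l; move: nu_ge0; nra.
Qed.

Lemma Pr_box_approx (D : {set 'I_d}) (v0 v1 : 'I_d -> 'I_n) : config D v0 v1 ->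
  `|Pr (box v0 v1 a) - p ^+ (2 ^ #|D|)| <= err d.
Proof.
move=> cf; have Dd : (#|D| <= d)%N by have := max_card (mem D); rewrite card_ord.
have h1 := Pr_box_upper (subnKC Dd) cf.
have h2 := Pr_box_lower (erefl _) cf.
have e1 : err (d - #|D|) <= err d by apply: err_mono; rewrite leq_subr.
have e2 : (2 ^+ (#|D| + 2) - 3) * (2 * eta + nu) <= err d.
  have X0 : 0 <= z ^+ (2 ^ (2 * d - d)) by rewrite exprn_ge0 //; case/andP: z01.
  apply: le_trans (_ : 1 * z ^+ (2 ^ (2 * d - d)) <= _).
    rewrite mul1r; apply: le_trans (small_le d).
    rewrite ler_wpM2r ?addr_ge0 ?mulr_ge0 //.
    have : 2 ^+ (#|D| + 2) <= 2 ^+ (d + 2) :> R.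
      by rewrite ler_eXn2l ?ltr1n // leq_add2r.
    by lra.
  by rewrite ler_wpM2r // ler1n.
by rewrite ler_norml; apply/andP; split; lra.
Qed.

(* For [j \in Rs], Cauchy-Schwarz in the position of the vertex [v0 j] removes
   the sets of [w] that miss it and doubles the [j]-th side of the box. *)
Lemma box_counting r (Rs D : {set 'I_d}) (U : {set 'I_n}) (v0 v1 : 'I_d -> 'I_n) w :
  #|Rs| = r -> [disjoint Rs & D] -> config D v0 v1 ->
  (forall i, v0 i \in U /\ v1 i \in U) -> (#|U| + r <= B)%N ->
  uniform_in d U w ->
  (forall sa, sa \in w -> exists2 i, i \in Rs & v0 i \notin sa.1) ->
  `|Pr (w ++ box v0 v1 a) - p ^+ (2 ^ #|D|) * Pr w| <= err (d + r).
Proof.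
elim: r Rs D U v0 v1 w => [|r IH] Rs D U v0 v1 w Rr dis cf vU UB wU miss.
  (* With [Rs] empty no set of [w] can miss one of its vertices, so [w] is empty and only the box is
     left. *)
  case: w wU miss => [|sa w] wU miss; last first.
    have [i] := miss sa (mem_head _ _).
    by have -> : Rs = finset.set0 by [apply/eqP; rewrite -cards_eq0 Rr]; rewrite inE.
  have -> : Pr [::] = 1 by rewrite /Pr prob_expect /= expect_const.
  by rewrite mulr1 addn0; apply: Pr_box_approx.
have [j jR] : exists j, j \in Rs by apply/card_gt0P; rewrite Rr.
have jD : j \notin D by rewrite (disjointFr dis jR).
have Rr' : #|Rs :\ j| = r by apply: succn_inj; rewrite -Rr (cardsD1 j Rs) jR.
have roomU : (#|U| * N <= n)%N.
  apply: leq_trans room; rewrite leq_mul2r; apply/orP; right.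
  exact: leq_trans (leq_addr _ _) UB.
have [v0U v1U] : (forall i, v0 i \in U) /\ (forall i, v1 i \in U).
  by split=> i; case: (vU i).
have v1j : v1 j = v0 j by case: cf => _ ->.
have ne b i : i != j -> (if b then v1 i else v0 i) != v0 j.
  move=> ij; apply/eqP => e; case/eqP: ij.
  exact: (@config_inj _ _ _ _ _ cf b false).
pose psi t := blow N U (v0 j) t.
(* The part [G] does not feel a shift of [v0 j] and serves as the bounded factor discarded by
   Cauchy-Schwarz. Only [K] and the box move with [t]. *)
pose G := [seq sa : {set 'I_n} * T <- w | v0 j \notin sa.1].
pose K := [seq sa : {set 'I_n} * T <- w | ~~ (v0 j \notin sa.1)].
pose H t := box (psi t \o v0) (psi t \o v1) a.
pose q := p ^+ (2 ^ #|D|).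
have /andP[q0 q1] : 0 <= q <= 1 by apply: pX.
have inc t : (t < N)%N -> increasing_on U (psi t) by apply: blow_increasing.
have moveG t : move (psi t) G = move (psi 0%N) G.
  apply/eq_in_map => sa; rewrite mem_filter => /andP[js _]; congr (_, _).
  apply: eq_in_imset => u us; apply: blow_fix; apply: contraNneq js => <-.
  exact: us.
pose one w' (x : array n d T) : R := (matches w' x)%:R.
have one01 w' x : 0 <= one w' x <= 1 by rewrite ler0n lern1 leq_b1.
have oneM w1 w2 x : one w1 x * one w2 x = one (w1 ++ w2) x.
  by rewrite /one matches_cat -natrM mulnb.
pose k t x := one (move (psi t) K) x * (one (H t) x - q).
have moveW t x : matches (move (psi t) w) x
    = matches (move (psi 0%N) G) x && matches (move (psi t) K) x.
  by rewrite -(moveG t); apply: matches_move_filter.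
have E1 t : (t < N)%N ->
    expect mu (fun x => one (move (psi 0%N) G) x * k t x)
    = Pr (move (psi t) (w ++ box v0 v1 a)) - q * Pr (move (psi t) w).
  move=> tN; rewrite /Pr !prob_expect -expectZ -expectB; apply: eq_expect => x.
  rewrite move_cat move_box matches_cat moveW /k /one /H.
  by do 3 case: (matches _ x) => /=; ring.
have Ekk t t' : expect mu (fun x => k t x * k t' x)
    = expect mu (fun x => one ((move (psi t) K ++ move (psi t') K)
                               ++ (H t ++ H t')) x)
      - q * Pr ((move (psi t) K ++ move (psi t') K) ++ H t)
      - q * Pr ((move (psi t) K ++ move (psi t') K) ++ H t')
      + q ^+ 2 * Pr (move (psi t) K ++ move (psi t') K).
  rewrite /Pr !prob_expect -!expectZ -!expectB -expectD.
  by apply: eq_expect => x; rewrite -!/(one _ _) -!oneM /k; ring.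
have rd : (r.+1 <= d)%N by have := max_card (mem Rs); rewrite card_ord Rr.
apply: le_trans (_ : 2 * (2 * eta) + Num.sqrt (nu + 3 * err (d + r)) <= _);
  last first.
  by rewrite addnS; apply: err_step; rewrite mul2n -addnn ltn_add2l.
apply: (@avg_cauchy_schwarz _ _ mu mu_distr N k (one (move (psi 0%N) G))) => //.
- by move=> x; case/andP: (one01 (move (psi 0%N) G) x) => h0 h1; rewrite ger0_norm.
- move=> t x; rewrite /k normrM.
  have /andP[h0 h1] := one01 (move (psi t) K) x.
  have /andP[h2 h3] := one01 (H t) x.
  apply: mulr_ile1 => //; first by rewrite ger0_norm.
  by rewrite ler_norml; apply/andP; split; lra.
- move=> t; rewrite (E1 t (ltn_ord t)).
  have bU := box_uniform (a := a) cf vU.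
  have wbU : uniform_in d U (w ++ box v0 v1 a) by apply/uniform_in_cat.
  have g1 := Pr_move wbU (inc _ (ltn_ord t)).
  have g2 := Pr_move wU (inc _ (ltn_ord t)).
  rewrite (_ : _ - _ = (Pr (w ++ box v0 v1 a) - Pr (move (psi t) (w ++ box v0 v1 a)))
     - q * (Pr w - Pr (move (psi t) w))); last by rewrite /q; ring.
  apply: le_trans (ler_normB _ _) _; rewrite normrM (ger0_norm q0).
  rewrite [leRHS](_ : _ = 2 * eta + 1 * (2 * eta)); last by ring.
  by apply: lerD => //; apply: ler_pM.
- by rewrite mulr_ge0.
move=> t t' tt'; rewrite Ekk; set w' := _ ++ move _ K.
have [tN t'N] := (ltn_ord t, ltn_ord t').
(* The two shifted copies of [U] differ only at [v0 j], so each step adds a single vertex; this is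
   why [#|U| + r <= B] is the invariant. *)
pose U' := psi t' (v0 j) |: psi t @: U.
have fixpsi u : u != v0 j -> psi t u = psi t' u by apply: blow_fix.
have psitU u : u \in U -> psi t u \in U' by move=> uU; rewrite !inE imset_f ?orbT.
have psit'U u : u \in U -> psi t' u \in U'.
  have [-> _|un] := eqVneq u (v0 j); first by rewrite !inE eqxx.
  by rewrite -fixpsi //; apply: psitU.
have U'B : (#|U'| + r <= B)%N.
  apply: leq_trans UB; rewrite addnS -addSn leq_add2r /U' cardsU1 -add1n.
  by apply: leq_add; [exact: leq_b1|exact: leq_imset_card].
have KU : uniform_in d U K.
  by move=> sa; rewrite mem_filter => /andP[_]; apply: wU.
have w'U : uniform_in d U' w'.
  apply/uniform_in_cat; split.
    apply: uniform_in_sub (uniform_in_move (inc _ tN) KU).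
    by apply/fintype.subsetP => _ /imsetP[u uU ->]; apply: psitU.
  apply: uniform_in_sub (uniform_in_move (inc _ t'N) KU).
  by apply/fintype.subsetP => _ /imsetP[u uU ->]; apply: psit'U.
(* A set of [K] contains [v0 j], so the vertex it misses has another index [i] in [Rs], which
   remains available after [j] is removed. This is why [G] had to be discarded. *)
have w'miss sa : sa \in w' -> exists i, [/\ i != j, i \in Rs :\ j,
    psi t (v0 i) \notin sa.1 & psi t' (v0 i) \notin sa.1].
  have HK (y : 'I_N) (sb : {set 'I_n} * T) : sb \in K ->
      exists i, [/\ i != j, i \in Rs :\ j & psi y (v0 i) \notin psi y @: sb.1].
    rewrite mem_filter negbK => /andP[jsb sbw].
    have [i iR is_] := miss _ sbw.
    have ij : i != j by apply: contraNneq is_ => ->.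
    exists i; split=> //; first by rewrite !inE ij.
    apply/imsetP => -[u us e]; case/negP: is_.
    rewrite (increasing_on_inj (inc _ (ltn_ord y)) _ _ e) //.
    by have [_ /fintype.subsetP] := wU _ sbw; apply.
  rewrite mem_cat => /orP[] /mapP[sb /HK sbK -> /=].
    have [i [ij iR h]] := sbK t; exists i; split=> //.
    by rewrite -fixpsi //; apply: (ne false).
  have [i [ij iR h]] := sbK t'; exists i; split=> //.
  by rewrite fixpsi //; apply: (ne false).
have dis' : [disjoint Rs :\ j & D].
  by apply: disjointWl dis; apply: finset.subD1set.
have cf_t y : (y < N)%N -> config D (psi y \o v0) (psi y \o v1).
  by move=> yN; apply: (config_move cf vU); apply: inc.
have L1 := IH _ D U' (psi t \o v0) (psi t \o v1) w' Rr' dis' (cf_t _ tN).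
have L2 := IH _ D U' (psi t' \o v0) (psi t' \o v1) w' Rr' dis' (cf_t _ t'N).
have L1' : `|Pr (w' ++ H t) - q * Pr w'| <= err (d + r).
  apply: L1 => //; first by move=> i; split; apply: psitU.
  by move=> sa /w'miss[i [_ h1 h2 _]]; exists i.
have L2' : `|Pr (w' ++ H t') - q * Pr w'| <= err (d + r).
  apply: L2 => //; first by move=> i; split; apply: psit'U.
  by move=> sa /w'miss[i [_ h1 _ h2]]; exists i.
pose v1' i := if i == j then psi t' (v0 j) else psi t (v1 i).
have cf2 : config (j |: D) (psi t \o v0) v1'.
  exact: (config_double roomU cf vU jD tt' t'N).
have L3 : `|Pr (w' ++ box (psi t \o v0) v1' a) - q ^+ 2 * Pr w'| <= err (d + r).
  have -> : q ^+ 2 = p ^+ (2 ^ #|j |: D|) by rewrite cardsU1 jD /q -exprM -expnSr.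
  apply: (IH (Rs :\ j) _ U') => //.
  - apply/pred0P => i /=; rewrite !inE; have [_|_ /=] := eqVneq i j; first by [].
    by apply/negbTE/negP => /andP[iR]; rewrite (disjointFr dis iR).
  - move=> i; split; first exact: psitU.
    by rewrite /v1'; case: eqP => _; [apply: psit'U|apply: psitU].
  - by move=> sa /w'miss[i [_ h1 h2 _]]; exists i.
have -> : expect mu (fun x => one (w' ++ (H t ++ H t')) x)
    = Pr (w' ++ box (psi t \o v0) v1' a).
  rewrite /Pr prob_expect; apply: eq_expect => x; congr (_%:R).
  rewrite !matches_cat /H; congr (_ && _).
  rewrite -(matches_box_double a (j := j)) //=; rewrite ?v1j //.
    by move=> i ij; apply: fixpsi; apply: (ne false).
  by move=> i ij; apply: fixpsi; apply: (ne true).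
(* The main terms [q ^+ 2 - 2 * q ^+ 2 + q ^+ 2] cancel. There remain one error from the doubled box
   and two weighted by [q <= 1], at most [3 * err (d + r)]. *)
move: L1' L2' L3; rewrite !ler_norml.
move=> /andP[l1 _] /andP[l2 _] /andP[_ l3].
have e0 := err_ge0 (d + r).
by nra.
Qed.

End Counting.

(** * The canonical box *)

Lemma increasing_enumeration n d (s : {set 'I_n}) : #|s| = d ->
  exists2 v : 'I_d -> 'I_n, strictly_increasing v & [set v i | i : 'I_d] = s.
Proof.
move=> <-; exists (fun i : 'I_#|s| => enum_val i); first exact: enum_val_increasing.
apply/setP => u; apply/imsetP/idP => [[i _ ->]|us]; first exact: enum_valP.
by exists (enum_rank_in us u); rewrite ?enum_rankK_in.
Qed.

Lemma config_set0 n d (v : 'I_d -> 'I_n) :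
  strictly_increasing v -> config finset.set0 v v.
Proof. by move=> iv; split=> // i; rewrite inE. Qed.

Lemma xat_val n d (T : finType) (x : array n d T) (s : dsub n d) :
  xat x (val s) = Some (x s).
Proof. by rewrite /xat valK. Qed.

Lemma matches_box_set0 n d (T : finType) (v : 'I_d -> 'I_n) (a : T)
    (x : array n d T) :
  matches (box v v a) x = (xat x [set v i | i : 'I_d] == Some a).
Proof.
have E (om : {ffun 'I_d -> bool}) : corner v v om = [set v i | i : 'I_d].
  by apply: eq_imset => i; rewrite if_same.
rewrite matches_box; apply/forallP/idP => [/(_ [ffun=> false])|h om]; by rewrite E.
Qed.

Lemma prod_ler_approx (R : realType) (I : Type) (r : seq I) (F : I -> R) (q del : R) :
  0 <= q <= 1 -> 0 <= del -> (forall i, 0 <= F i <= 1) ->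
  (forall i, F i <= q + del) ->
  \prod_(i <- r) F i <= q ^+ size r + (size r)%:R * del.
Proof.
move=> /andP[q0 q1] del0 F01 Fq; elim: r => [|i r IH].
  by rewrite big_nil expr0 mul0r addr0.
rewrite big_cons /= exprS -natr1; have /andP[f0 f1] := F01 i.
have Q0 : 0 <= q ^+ size r by apply: exprn_ge0.
have Q1 : q ^+ size r <= 1 by apply: exprn_ile1.
apply: le_trans (ler_wpM2l f0 IH) _.
have h1 := ler_wpM2r Q0 (Fq i).
have h2 : F i * ((size r)%:R * del) <= 1 * ((size r)%:R * del).
  by rewrite ler_wpM2r // mulr_ge0.
have h3 : del * q ^+ size r <= del * 1 by rewrite ler_wpM2l.
by rewrite !mulrDr !mulrDl in h1 h2 h3 *; lra.
Qed.

Section CanonicalBox.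
Variables (n d : nat).
Hypothesis room : (d + d <= n)%N.

Let even_room (i : 'I_d) : (i.*2 < n)%N.
Proof. by rewrite -addnn; have := ltn_ord i; move: room; lia. Qed.

Let odd_room (i : 'I_d) : (i.*2.+1 < n)%N.
Proof. by rewrite -addnn; have := ltn_ord i; move: room; lia. Qed.

Definition box0 (i : 'I_d) : 'I_n := Ordinal (even_room i).
Definition box1 (i : 'I_d) : 'I_n := Ordinal (odd_room i).

Lemma config_box : config [set: 'I_d] box0 box1.
Proof.
split=> [i _ /=|i|i j /= ij]; rewrite ?inE //.
by rewrite -[in X in (_ < X)%N]addnn -addnn; lia.
Qed.

Definition box_corner (om : {ffun 'I_d -> bool}) : dsub n d :=
  exist (fun s : {set 'I_n} => is_true (#|s| == d)) (corner box0 box1 om)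
    (introT eqP (card_corner config_box om)).

Let half_vertex b (i : 'I_d) : (if b then box1 i else box0 i)./2 = i.
Proof. by case: b => /=; rewrite ?uphalf_double ?doubleK. Qed.

Let odd_vertex b (i : 'I_d) : odd (if b then box1 i else box0 i) = b.
Proof. by case: b => /=; rewrite odd_double. Qed.

Lemma box_corner_inj : injective box_corner.
Proof.
move=> om om' /(congr1 val) /= e; apply/ffunP => i.
have : (if om i then box1 i else box0 i) \in corner box0 box1 om'.
  by rewrite -e; apply/imsetP; exists i.
case/imsetP => j _ ej.
have ij : i = j.
  by apply/val_inj; rewrite /= -(half_vertex (om i) i) ej half_vertex.
by rewrite -(odd_vertex (om i) i) ej ij odd_vertex.
Qed.

(** The choice [om i] is the parity of the vertex of [s] in the [i]-th pair. Having [d] elements and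
    one in each of the [d] pairs, [s] has no further vertices. *)
Lemma Box_corners : Box n d = [set box_corner om | om : {ffun 'I_d -> bool}].
Proof.
apply/setP => s; rewrite inE; apply/forallP/imsetP => [h|[om _ ->] i]; last first.
  apply/cards1P; exists (if om i then box1 i else box0 i); apply/setP => x.
  rewrite !inE; apply/andP/eqP => [[/imsetP[j _ ->]]|->].
    by rewrite half_vertex => /eqP/val_inj ->.
  by rewrite half_vertex eqxx; split=> //; apply/imsetP; exists i.
have ex (i : 'I_d) : exists x : 'I_n, x \in val s /\ x./2 = i.
  have /cards1P[x /setP/(_ x)] := h i; rewrite !inE eqxx => /andP[xs /eqP e].
  by exists x.
have [f fP] := fin_all_exists ex.
exists [ffun i => odd (f i)] => //.
have fE i : (if [ffun i => odd (f i)] i then box1 i else box0 i) = f i.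
  have [_ fi] := fP i; apply/val_inj; rewrite /= -[RHS](odd_double_half (f i)) fi ffunE.
  by case: (odd (f i)).
apply/val_inj/eqP; rewrite eq_sym eqEcard /= (card_corner config_box).
rewrite (eqP (valP s)) leqnn andbT.
apply/fintype.subsetP => x /imsetP[i _ ->]; rewrite fE.
by case: (fP i).
Qed.

Lemma matches_full_box (T : finType) (a : T) (x : array n d T) :
  matches (box box0 box1 a) x = [forall s in Box n d, x s == a].
Proof.
rewrite matches_box Box_corners; apply/forallP/forall_inP => [h s /imsetP[om _ ->]|h om].
  have := h om; rewrite (_ : corner _ _ om = val (box_corner om)) // xat_val.
  by move=> /eqP[->].
rewrite (_ : corner _ _ om = val (box_corner om)) // xat_val.
by rewrite (eqP (h _ _)) //; apply/imset_f.
Qed.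

Lemma prod_Box (R : realType) (F : dsub n d -> R) (q del : R) :
  0 <= q <= 1 -> 0 <= del -> (forall i, 0 <= F i <= 1) ->
  (forall i, F i <= q + del) ->
  \prod_(s in Box n d) F s <= q ^+ (2 ^ d) + 2 ^+ d * del.
Proof.
move=> q01 del0 F01 Fq; rewrite Box_corners big_imset /=; last first.
  by move=> ? ? _ _; apply: box_corner_inj.
rewrite -big_enum /=; apply: le_trans (prod_ler_approx _ q01 del0 _ _) _ => //.
rewrite -cardE (eq_card (B := predT)) // card_ffun card_bool card_ord.
by rewrite natrX.
Qed.

End CanonicalBox.

(** * Nearly independent entries *)

Section NearlyIndependentEntries.
Variables (R : realType) (n d : nat) (T : finType) (mu : array n d T -> R).
Variables (eta : R) (B N : nat) (z : R) (S : {set T}) (s0 : dsub n d).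
Hypothesis mu_distr : is_distr mu.
Hypothesis eta0 : 0 <= eta.
Hypothesis spr : spreadable mu eta.
Hypothesis N0 : (0 < N)%N.
Hypothesis room : (B * N <= n)%N.
Hypothesis dB : (d + d <= B)%N.
Hypothesis z01 : 0 <= z <= 1.
Hypothesis z_dom : 2 ^+ (d + 2) * (2 * eta + N%:R^-1) <= z ^+ (2 ^ (2 * d)).
Hypothesis T0 : (0 < #|T|)%N.
Hypothesis cardS : #|S| = (#|T| - 1)%N.
Hypothesis box_indep : forall a, a \in S ->
  `| prob mu (fun x => [forall s in Box n d, x s == a])
     - \prod_(s in Box n d) prob mu (fun x => x s == a) | <= eta.

(** The law of one reference entry; by spreadability it stands for the law of every entry, up to
    [2 * eta]. *)
Definition marginal (a : T) : R := prob mu (fun x => x s0 == a).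

Let Pr (w : pattern n T) := prob mu (matches w).

Lemma prob01 (P : pred (array n d T)) : 0 <= prob mu P <= 1.
Proof.
rewrite prob_expect; apply/andP; split.
  by apply: expect_ge0 => // x; rewrite ler0n.
by apply: expect_ler => // x; rewrite lern1 leq_b1.
Qed.

Lemma prob_entry (s : dsub n d) (a : T) :
  prob mu (fun x => x s == a) = Pr [:: (val s, a)].
Proof. by apply: eq_bigl => x; rewrite /matches /= xat_val andbT. Qed.

Let Pr_single (a : T) (s : {set 'I_n}) : #|s| = d ->
  `|Pr [:: (s, a)] - marginal a| <= 2 * eta.
Proof.
move=> cs; rewrite /marginal prob_entry.
have [v iv vs] := increasing_enumeration cs.
have [v' iv' vs'] := increasing_enumeration (eqP (valP s0)).
have := Pr_config a mu_distr eta0 spr (config_set0 iv) (config_set0 iv').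
have E u : prob mu (matches (box u u a)) = Pr [:: ([set u i | i : 'I_d], a)].
  by apply: eq_bigl => x; rewrite matches_box_set0 /matches /= andbT.
by rewrite !E vs vs'.
Qed.

Lemma sum_marginal : \sum_a marginal a = 1.
Proof.
rewrite /marginal /prob -(mu_distr.2).
by rewrite [RHS](partition_big (fun x : array n d T => x s0) predT).
Qed.

Let marginal01 a : 0 <= marginal a <= 1. Proof. exact: prob01. Qed.

Let room' : (d + d <= n)%N.
Proof. by apply: leq_trans room; apply: leq_trans dB _; apply: leq_pmulr. Qed.

(** [box_counting] for the fully degenerate box, which is the single set [s], with all [d] sides
    available in [Rs]: a different set of size [d] misses some vertex of [s]. After [2 * d] steps
    the error is [16 * z ^+ 1]. *)
Lemma counting_entry a (s : {set 'I_n}) (U : {set 'I_n}) (w : pattern n T) :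
  a \in S -> #|s| = d -> s \subset U -> (#|U| + d <= B)%N -> uniform_in d U w ->
  (forall sa, sa \in w -> sa.1 != s) ->
  `|Pr ((s, a) :: w) - marginal a * Pr w| <= 16 * z.
Proof.
move=> aS cs sU UB wU ws.
have [v iv vs] := increasing_enumeration cs.
have full : Pr (box (box0 room') (box1 room') a)
    <= marginal a ^+ (2 ^ d) + 2 ^+ d * (2 * eta) + eta.
  have -> : Pr (box (box0 room') (box1 room') a)
      = prob mu (fun x => [forall s in Box n d, x s == a]).
    by apply: eq_bigl => x; apply: matches_full_box.
  have := box_indep aS; rewrite ler_norml => /andP[_ h].
  have : \prod_(s in Box n d) prob mu (fun x => x s == a)
      <= marginal a ^+ (2 ^ d) + 2 ^+ d * (2 * eta).
    apply: (prod_Box room') => //; first by rewrite mulr_ge0.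
      by move=> s'; apply: prob01.
    move=> s'; rewrite prob_entry.
    by have := Pr_single a (eqP (valP s')); rewrite ler_norml => /andP[_]; lra.
  by move: h; lra.
have miss sa : sa \in w -> exists2 i, i \in [set: 'I_d] & v i \notin sa.1.
  move=> sw; have [csa saU] := wU _ sw; have := ws _ sw.
  case: (boolP [exists i, v i \notin sa.1]) => [/existsP[i h] _|].
    by exists i; rewrite ?inE.
  rewrite negb_exists => /forallP h /negP[]; rewrite eq_sym eqEcard csa cs leqnn andbT.
  apply/fintype.subsetP => u; rewrite -vs => /imsetP[i _ ->].
  by have := h i; rewrite negbK.
have cT : #|[set: 'I_d]| = d by rewrite cardsT card_ord.
have vU i : v i \in U /\ v i \in U.
  by have : v i \in s by [rewrite -vs imset_f]; move=> /(fintype.subsetP sU).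
have dis : [disjoint [set: 'I_d] & (finset.set0 : {set 'I_d})].
  by apply/pred0P => i /=; rewrite !inE.
have := box_counting mu_distr eta0 spr N0 room dB (marginal01 a) (Pr_single a)
  (config_box room') full z01 z_dom cT dis (config_set0 iv) vU UB wU miss.
rewrite cards0 expn0 expr1 mul2n -addnn subnn expn0 expr1.
have -> // : prob mu (matches (w ++ box v v a)) = Pr ((s, a) :: w).
by apply: eq_bigl => x; rewrite matches_cat matches_box_set0 vs andbC.
Qed.

Let e : R := #|T|%:R * (16 * z).

Let e_ge : 16 * z <= e.
Proof.
case/andP: z01 => z0 z1; rewrite /e ler_peMl ?mulr_ge0 //.
by rewrite ler1n.
Qed.

(** For the one value outside [S], both the conditioned probabilities and the marginals add up over
    all values, so its deviation is minus the sum of the deviations over [S]. This costs the factor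
    [#|T|] in [e]. *)
Lemma counting_entry_all a (s : {set 'I_n}) (U : {set 'I_n}) (w : pattern n T) :
  #|s| = d -> s \subset U -> (#|U| + d <= B)%N -> uniform_in d U w ->
  (forall sa, sa \in w -> sa.1 != s) ->
  `|Pr ((s, a) :: w) - marginal a * Pr w| <= e.
Proof.
move=> cs sU UB wU ws.
case: (boolP (a \in S)) => aS.
  exact: le_trans (counting_entry aS cs sU UB wU ws) e_ge.
have SE : S = [set~ a].
  apply/eqP; rewrite eqEcard cardsC1 cardS subn1 leqnn andbT.
  by apply/fintype.subsetP => b bS; rewrite !inE; apply: contraNneq aS => <-.
have tot : Pr w = \sum_b Pr ((s, b) :: w).
  have sd : #|s| == d by apply/eqP.
  pose sw : dsub n d := exist (fun s : {set 'I_n} => is_true (#|s| == d)) s sd.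
  rewrite /Pr /prob (partition_big (fun x : array n d T => x sw) predT) //=.
  apply: eq_bigr => b _; apply: eq_bigl => x.
  by rewrite /matches /= (_ : s = val sw) // xat_val andbC.
have e1 : Pr w = Pr ((s, a) :: w) + \sum_(b in S) Pr ((s, b) :: w).
  rewrite tot (bigD1 a) //=; congr (_ + _); apply: eq_bigl => b.
  by rewrite SE !inE.
have e2 : 1 = marginal a + \sum_(b in S) marginal b.
  rewrite -sum_marginal (bigD1 a) //=; congr (_ + _); apply: eq_bigl => b.
  by rewrite SE !inE.
have -> : Pr ((s, a) :: w) - marginal a * Pr w
    = - \sum_(b in S) (Pr ((s, b) :: w) - marginal b * Pr w).
  rewrite sumrB -mulr_suml.
  rewrite (_ : Pr ((s, a) :: w) = Pr w - \sum_(b in S) Pr ((s, b) :: w)); last first.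
    by rewrite [in RHS]e1 addrK.
  rewrite (_ : marginal a = 1 - \sum_(b in S) marginal b); last by rewrite e2 addrK.
  by ring.
rewrite normrN; apply: le_trans (ler_norm_sum _ _ _) _.
apply: le_trans (_ : \sum_(b in S) (16 * z) <= _).
  by apply: ler_sum => b bS; apply: (counting_entry (U := U)).
case/andP: z01 => z0 z1.
rewrite sumr_const -[leLHS]mulr_natl /e ler_wpM2r ?mulr_ge0 // ler_nat cardS.
exact: leq_subr.
Qed.

(** Entries are split off one at a time; since the marginals are at most 1, the errors just add. *)
Lemma entries_nearly_iid (r : seq (dsub n d)) (y : array n d T) (U : {set 'I_n}) :
  uniq r -> (forall s, s \in r -> val s \subset U) -> (#|U| + d <= B)%N ->
  `|prob mu (fun x => all (fun s => x s == y s) r) - \prod_(s <- r) marginal (y s)|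
  <= (size r)%:R * e.
Proof.
pose wr (r : seq (dsub n d)) : pattern n T := [seq (val s, y s) | s <- r].
have PE (q : seq (dsub n d)) : prob mu (fun x => all (fun s => x s == y s) q) = Pr (wr q).
  apply: eq_bigl => x; rewrite /matches all_map; apply: eq_all => s /=.
  by rewrite xat_val.
move=> ur rU UB; rewrite PE; elim: r ur rU => [|s r IH] /=.
  move=> _ _; rewrite big_nil mul0r /Pr prob_expect.
  by rewrite (expect_const mu_distr 1) subrr normr0.
move=> /andP[sr ur] rU; rewrite big_cons -natr1.
have rU' s' : s' \in r -> val s' \subset U.
  by move=> s'r; apply: rU; rewrite inE s'r orbT.
have {}IH := IH ur rU'.
have sU := rU s (mem_head _ _).
have wU : uniform_in d U (wr r).
  move=> _ /mapP[s' s'r ->] /=; split; first exact: (eqP (valP s')).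
  exact: rU'.
have ws sa : sa \in wr r -> sa.1 != val s.
  move=> /mapP[s' s'r ->] /=; apply: contraNneq sr => /val_inj <-.
  by [].
have h := counting_entry_all (y s) (eqP (valP s)) sU UB wU ws.
have /andP[m0 m1] := marginal01 (y s).
rewrite (_ : _ - _ = (Pr ((val s, y s) :: wr r) - marginal (y s) * Pr (wr r))
  + marginal (y s) * (Pr (wr r) - \prod_(j <- r) marginal (y j))); last by ring.
apply: le_trans (ler_normD _ _) _; rewrite normrM (ger0_norm m0) mulrDl mul1r addrC.
apply: lerD => //; apply: le_trans IH.
by rewrite ler_piMl.
Qed.

End NearlyIndependentEntries.

(** * Functions of disjoint blocks of entries *)

Definition depends_on (R : realType) (I T : finType) (F : {set I})
    (u : {ffun I -> T} -> R) : Prop :=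
  forall x x' : {ffun I -> T}, (forall s, s \in F -> x s = x' s) -> u x = u x'.

Section Dissociation.
Variables (R : realType) (I T : finType) (mu : {ffun I -> T} -> R) (t0 : T).
Variables (F0 : {set I}) (pi : T -> R) (e : R).
Implicit Types (F G : {set I}) (u v : {ffun I -> T} -> R) (x y : {ffun I -> T}).
Hypothesis mu_distr : is_distr mu.
Hypothesis pi01 : forall a, 0 <= pi a <= 1.
Hypothesis e0 : 0 <= e.
Hypothesis nearly_iid : forall (r : seq I) y, uniq r -> {subset r <= F0} ->
  `|prob mu (fun x => all (fun s => x s == y s) r) - \prod_(s <- r) pi (y s)|
  <= (size r)%:R * e.

Let atom F y x : bool := all (fun s => x s == y s) (enum F).
(** One array for each assignment of values on [F], normalised to [t0] elsewhere; the events
    [atom F y] for these [y] partition the space. *)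
Let reps F : pred {ffun I -> T} := pffun_on t0 F predT.

Lemma depends_expand F u x : depends_on F u ->
  u x = \sum_(y in reps F) u y * (atom F y x)%:R.
Proof.
move=> uF; pose y0 : {ffun I -> T} := [ffun s => if s \in F then x s else t0].
have y0F : y0 \in reps F.
  apply/pffun_onP; split; last by [].
  by apply/fintype.subsetP => s; rewrite !inE ffunE; case: (s \in F) => //; rewrite eqxx.
rewrite (bigD1 y0) //= big1 ?addr0 => [|y /andP[yF ne]].
  have -> : atom F y0 x.
    by apply/allP => s; rewrite mem_enum => sF; rewrite ffunE sF.
  by rewrite mulr1; apply: uF => s sF; rewrite ffunE sF.
case: (boolP (atom F y x)) => [/allP h|]; last by rewrite mulr0.
case/eqP: ne; apply/ffunP => s; rewrite ffunE; case: ifP => sF.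
  by apply/esym/eqP/h; rewrite mem_enum.
apply/eqP; move/pffun_onP: yF => [/fintype.subsetP/(_ s) hs _].
by apply: contraFT sF => h'; apply: hs; rewrite inE.
Qed.

Lemma expect_depends F u : depends_on F u ->
  expect mu u = \sum_(y in reps F) u y * prob mu (atom F y).
Proof.
move=> uF; rewrite (eq_expect mu (fun x => depends_expand x uF)) expect_sum.
by apply: eq_bigr => y _; rewrite expectZ prob_expect.
Qed.

(** Both functions are expanded over atoms. For each of the [#|T| ^ #|F :|: G|] pairs, the joint
    probability and the product of the two probabilities are each within [#|F :|: G| * e] of the
    same product of [pi], whence the factor 2. *)
Lemma approx_indep F G u v (A C : R) :
  [disjoint F & G] -> F \subset F0 -> G \subset F0 ->
  depends_on F u -> depends_on G v ->
  (forall x, `|u x| <= A) -> (forall x, `|v x| <= C) ->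
  `|expect mu (fun x => u x * v x) - expect mu u * expect mu v|
  <= (#|T| ^ #|F :|: G|)%:R * (A * C * (2 * #|F :|: G|%:R * e)).
Proof.
move=> dis FF GF uF vG uA vC.
have cFG : #|F :|: G| = (#|F| + #|G|)%N.
  by rewrite cardsU (disjoint_setI0 dis) cards0 subn0.
have A0 : 0 <= A by apply: le_trans (uA [ffun=> t0]).
have C0 : 0 <= C by apply: le_trans (vC [ffun=> t0]).
have prod01 (r : seq I) y : 0 <= \prod_(s <- r) pi (y s) <= 1.
  apply/andP; split; last exact: prodr_ile1.
  by apply: prodr_ge0 => s _; case/andP: (pi01 (y s)).
have prob01 P : 0 <= prob mu P <= 1.
  rewrite prob_expect; apply/andP; split.
    by apply: expect_ge0 => // x; rewrite ler0n.
  by apply: expect_ler => // x; rewrite lern1 leq_b1.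
have -> : expect mu (fun x => u x * v x) - expect mu u * expect mu v
    = \sum_(y in reps F) \sum_(y' in reps G) u y * v y' *
       (prob mu (fun x => atom F y x && atom G y' x)
        - prob mu (atom F y) * prob mu (atom G y')).
  rewrite (expect_depends uF) (expect_depends vG) big_distrl /=.
  have -> : expect mu (fun x => u x * v x)
      = \sum_(y in reps F) \sum_(y' in reps G) u y * v y' *
          prob mu (fun x => atom F y x && atom G y' x).
    transitivity (expect mu (fun x => \sum_(y in reps F) \sum_(y' in reps G)
        u y * v y' * (atom F y x && atom G y' x)%:R)).
      apply: eq_expect => x; rewrite (depends_expand x uF) (depends_expand x vG).
      rewrite big_distrl /=; apply: eq_bigr => y _.
      rewrite big_distrr /=; apply: eq_bigr => y' _.
      by rewrite mulrACA -natrM mulnb.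
    rewrite expect_sum; apply: eq_bigr => y _; rewrite expect_sum.
    by apply: eq_bigr => y' _; rewrite expectZ prob_expect.
  rewrite -sumrB; apply: eq_bigr => y _.
  rewrite big_distrr /= -sumrB; apply: eq_bigr => y' _.
  by rewrite mulrBr mulrACA.
have nn : 0 <= A * C * (2 * #|F :|: G|%:R * e) by rewrite !mulr_ge0.
have pt y y' : `|u y * v y' * (prob mu (fun x => atom F y x && atom G y' x)
        - prob mu (atom F y) * prob mu (atom G y'))|
    <= A * C * (2 * #|F :|: G|%:R * e).
  rewrite !normrM; apply: ler_pM => //; first by apply: ler_pM.
  pose yy : {ffun I -> T} := [ffun s => if s \in F then y s else y' s].
  have un : uniq (enum F ++ enum G).
    rewrite cat_uniq !enum_uniq andbT /=; apply/hasPn => s; rewrite !mem_enum => sG.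
    by rewrite (disjointFl dis sG).
  have sub : {subset enum F ++ enum G <= F0}.
    move=> s; rewrite mem_cat !mem_enum => /orP[].
      exact: (fintype.subsetP FF).
    exact: (fintype.subsetP GF).
  have h1 := nearly_iid yy un sub.
  have subF : {subset enum F <= F0}.
    by move=> s; rewrite mem_enum; apply: (fintype.subsetP FF).
  have subG : {subset enum G <= F0}.
    by move=> s; rewrite mem_enum; apply: (fintype.subsetP GF).
  have h2 := nearly_iid y (enum_uniq _) subF.
  have h3 := nearly_iid y' (enum_uniq _) subG.
  have yF s : s \in enum F -> yy s = y s by rewrite mem_enum ffunE => ->.
  have yG s : s \in enum G -> yy s = y' s.
    by rewrite mem_enum ffunE => sG; rewrite (disjointFl dis sG).
  have E1 : prob mu (fun x => all (fun s => x s == yy s) (enum F ++ enum G))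
      = prob mu (fun x => atom F y x && atom G y' x).
    apply: eq_bigl => x; rewrite all_cat.
    have -> : all (fun s => x s == yy s) (enum F) = atom F y x.
      by apply: eq_in_all => s sF; rewrite yF.
    have -> // : all (fun s => x s == yy s) (enum G) = atom G y' x.
    by apply: eq_in_all => s sG; rewrite yG.
  rewrite E1 big_cat /= (eq_big_seq (fun s => pi (y s))) in h1; last first.
    by move=> s sF; rewrite yF.
  rewrite [X in _ * X](eq_big_seq (fun s => pi (y' s))) in h1; last first.
    by move=> s sG; rewrite yG.
  rewrite size_cat -!cardE in h1 h2 h3.
  have /andP[a0 a1] := prod01 (enum F) y.
  have /andP[b0 b1] := prod01 (enum G) y'.
  have /andP[c0 c1] := prob01 (atom G y').
  rewrite cFG; move: h1 h2 h3; rewrite -/(atom F y) -/(atom G y').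
  set p12 := prob mu _; set p1 := prob mu _; set p2 := prob mu _ in c0 c1 *.
  set q1 := \prod_(_ <- _) _ in a0 a1 *; set q2 := \prod_(_ <- _) _ in b0 b1 *.
  move=> h1 h2 h3.
  rewrite (_ : p12 - p1 * p2 = (p12 - q1 * q2) - ((p1 - q1) * p2 + q1 * (p2 - q2)));
    last by ring.
  apply: le_trans (ler_normB _ _) _.
  have g : `|(p1 - q1) * p2 + q1 * (p2 - q2)| <= #|F|%:R * e + #|G|%:R * e.
    apply: le_trans (ler_normD _ _) _; rewrite !normrM (ger0_norm c0) (ger0_norm a0).
    apply: lerD.
      by apply: le_trans h2; rewrite ler_piMr.
    by apply: le_trans h3; rewrite ler_piMl.
  by rewrite natrD in h1 *; lra.
apply: le_trans (ler_norm_sum _ _ _) _.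
apply: le_trans (_ : \sum_(y in reps F) \sum_(y' in reps G)
   A * C * (2 * #|F :|: G|%:R * e) <= _).
  apply: ler_sum => y _; apply: le_trans (ler_norm_sum _ _ _) _.
  by apply: ler_sum => y' _; apply: pt.
have card_reps H : #|reps H| = (#|T| ^ #|H|)%N.
  by rewrite card_pffun_on; congr (_ ^ _)%N; apply: eq_card.
rewrite !sumr_const !card_reps -mulrnA -[leLHS]mulr_natl ler_wpM2r //.
by rewrite ler_nat -expnD cFG addnC.
Qed.

(** One factor is split off at a time, the others depending on a disjoint union of sets. Every
    splitting is charged the same amount, with [F0] in place of the actual union, and an expectation
    already split off contributes at most [K]. *)
Lemma approx_indep_prod (J : finType) (r : seq J) (Fs : J -> {set I})
    (Z : J -> {ffun I -> T} -> R) (K : R) :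
  uniq r -> (forall i j, i != j -> [disjoint Fs i & Fs j]) ->
  (forall j, Fs j \subset F0) -> (forall j, depends_on (Fs j) (Z j)) ->
  1 <= K -> (forall j x, `|Z j x| <= K) ->
  `|expect mu (fun x => \prod_(j <- r) Z j x) - \prod_(j <- r) expect mu (Z j)|
  <= (size r)%:R * (K ^+ size r * ((#|T| ^ #|F0|)%:R * (2 * #|F0|%:R * e))).
Proof.
move=> ur dis FsF0 ZF K1 ZK; have K0 : 0 <= K by apply: le_trans K1.
have T0 : (0 < #|T|)%N by apply/card_gt0P; exists t0.
set b := _%:R * (2 * _ * e).
have b0 : 0 <= b by rewrite !mulr_ge0.
elim: r ur => [|j r IH] /=.
  rewrite mul0r big_nil (@eq_expect _ _ mu _ (fun=> 1)).
    by rewrite expect_const // subrr normr0.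
  by move=> x; rewrite big_nil.
move=> /andP[jr ur]; rewrite big_cons.
rewrite (@eq_expect _ _ mu _ (fun x => Z j x * \prod_(i <- r) Z i x)); last first.
  by move=> x; rewrite big_cons.
pose G := \bigcup_(i in r) Fs i.
have Gd : depends_on G (fun x => \prod_(i <- r) Z i x).
  move=> x x' xx; rewrite !big_seq; apply: eq_bigr => i ir; apply: ZF => s si.
  by apply: xx; apply/bigcupP; exists i.
have disj : [disjoint Fs j & G].
  by apply/bigcup_disjointP => i ir; apply: dis; apply: contraNneq jr => ->.
have GF0 : G \subset F0 by apply/bigcupsP.
have ZrK x : `|\prod_(i <- r) Z i x| <= K ^+ size r.
  have -> : K ^+ size r = \prod_(i <- r) K.
    by rewrite big_const_seq count_predT iter_mulr_1.
  by rewrite normr_prod; apply: ler_prod => i _; rewrite normr_ge0 /=.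
have h := approx_indep disj (FsF0 j) GF0 (ZF j) Gd (ZK j) ZrK.
have FG : (#|Fs j :|: G| <= #|F0|)%N.
  by apply: subset_leq_card; rewrite finset.subUset FsF0.
have h' : `|expect mu (fun x => Z j x * \prod_(i <- r) Z i x)
    - expect mu (Z j) * expect mu (fun x => \prod_(i <- r) Z i x)|
    <= K ^+ (size r).+1 * b.
  apply: le_trans h _; rewrite /b mulrCA exprS.
  rewrite ler_wpM2l ?mulr_ge0 ?exprn_ge0 //; apply: ler_pM => //.
  - by rewrite !mulr_ge0.
  - by rewrite ler_nat leq_pexp2l.
  - by rewrite ler_wpM2r // ler_wpM2l // ler_nat.
rewrite (_ : _ - _ = (expect mu (fun x => Z j x * \prod_(i <- r) Z i x)
    - expect mu (Z j) * expect mu (fun x => \prod_(i <- r) Z i x))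
  + expect mu (Z j) * (expect mu (fun x => \prod_(i <- r) Z i x)
      - \prod_(i <- r) expect mu (Z i))); last by ring.
apply: le_trans (ler_normD _ _) _; rewrite normrM.
rewrite -natr1 mulrDl mul1r addrC; apply: lerD => //.
have := ler_pM (normr_ge0 _) (normr_ge0 _) (ler_norm_expect mu_distr (ZK j)) (IH ur).
by rewrite exprS -[K * _ * b]mulrA [X in _ -> _ <= X]mulrCA.
Qed.

End Dissociation.

(** * Correlated nearly independent families *)

Section ConditionalExpectation.
Variables (R : realType) (n d : nat) (T : finType) (mu : array n d T -> R).
Hypothesis mu_distr : is_distr mu.
Variables (J : {set 'I_n}).

Lemma agreeJ_sym (x x' : array n d T) : agreeJ J x x' = agreeJ J x' x.
Proof. by apply: eq_forallb => s; rewrite eq_sym. Qed.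

Lemma agreeJ_eq (x x' : array n d T) : agreeJ J x x' -> agreeJ J x =1 agreeJ J x'.
Proof.
move=> /forallP h y; apply: eq_forallb => s; case: (boolP (val s \subset J)) => //= sJ.
by have := h s; rewrite sJ => /eqP ->.
Qed.

Lemma condexp_agree (f : array n d T -> R) (x x' : array n d T) :
  agreeJ J x x' -> condexp mu f J x = condexp mu f J x'.
Proof. by move=> /agreeJ_eq h; rewrite /condexp !(eq_bigl _ _ h). Qed.

(** Averaging over atoms is self-adjoint: [phi] is constant on atoms, so [x] and [x'] can trade
    roles in the double sum over pairs in a common atom. *)
Lemma expect_condexp (f phi : array n d T -> R) :
  (forall x x', agreeJ J x x' -> phi x = phi x') ->
  expect mu (fun x => f x * phi x) = expect mu (fun x => condexp mu f J x * phi x).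
Proof.
move=> phiJ; pose D x := \sum_(x' | agreeJ J x x') mu x'.
have -> : expect mu (fun x => condexp mu f J x * phi x)
    = \sum_x \sum_(x' | agreeJ J x x') mu x' * f x' * phi x' / D x' * mu x.
  apply: eq_bigr => x _; rewrite /condexp mulrAC.
  rewrite big_distrl /= big_distrl /= big_distrr /=.
  apply: eq_bigr => x' xx'; rewrite -(phiJ _ _ xx').
  rewrite (_ : \sum_(y | agreeJ J x y) mu y = D x'); last exact: eq_bigl (agreeJ_eq xx').
  by ring.
rewrite (exchange_big_dep predT) //=; apply: eq_bigr => x _.
rewrite -big_distrr /=; have -> : \sum_(i | agreeJ J i x) mu i = D x.
  by apply: eq_bigl => y; apply: agreeJ_sym.
(* On an atom of mass 0 the quotient in [condexp] is 0 by convention; this is harmless because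
   [mu x = 0] there. *)
have [D0|D0] := eqVneq (D x) 0; last by rewrite mulrA divfK.
have -> : mu x = 0; last by rewrite !mul0r.
apply/eqP; rewrite eq_le mu_distr.1 andbT -D0 /D (bigD1 x) /=; last first.
  by apply/forallP => s; rewrite eqxx implybT.
by rewrite lerDl sumr_ge0 // => y _; apply: mu_distr.1.
Qed.

(** The sign of the conditional expectation is cut to 0 where its modulus is at most [eps]. What
    remains has measure above [eps] and modulus above [eps], whence [eps ^+ 2]. *)
Lemma condexp_witness (f : array n d T -> R) (eps : R) :
  0 < eps -> prob mu (fun x => `|condexp mu f J x| <= eps) < 1 - eps ->
  exists phi : array n d T -> R,
    [/\ depends_on [set s : dsub n d | val s \subset J] phi,
        forall x, `|phi x| <= 1 & eps ^+ 2 <= expect mu (fun x => f x * phi x)].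
Proof.
move=> eps0 small; pose c := condexp mu f J.
pose phi x := Num.sg (c x) * (eps < `|c x|)%R%:R.
have phiJ x x' : agreeJ J x x' -> phi x = phi x'.
  by move=> h; rewrite /phi /c (condexp_agree f h).
exists phi; split=> [x x' h|x|].
- by apply: phiJ; apply/forallP => s; apply/implyP => sJ; rewrite h ?inE.
- rewrite /phi normrM normr_sg; apply: mulr_ile1 => //.
    by rewrite lern1 leq_b1.
  by rewrite ger0_norm ?ler0n // lern1 leq_b1.
rewrite expect_condexp //.
have -> : expect mu (fun x => condexp mu f J x * phi x)
    = expect mu (fun x => `|c x| * (eps < `|c x|)%R%:R).
  by apply: eq_expect => x; rewrite /phi mulrA -/(c x) [c x * _]mulrC -normrEsg.
apply: le_trans (_ : expect mu (fun x => eps * (eps < `|c x|)%R%:R) <= _).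
  rewrite expectZ expr2 ler_pM2l //.
  have e1 : expect mu (fun x => (eps < `|c x|)%R%:R)
      = 1 - prob mu (fun x => `|c x| <= eps).
    rewrite prob_expect -[X in X - _](expect_const mu_distr) -expectB.
    apply: eq_expect => x.
    by rewrite ltNge; case: (_ <= _) => /=; rewrite ?subrr ?subr0.
  by rewrite e1; move: small; rewrite -/c; lra.
apply: ler_expect => // x; case: ltP => h; last by rewrite !mulr0.
by rewrite !mulr1 ltW.
Qed.

End ConditionalExpectation.

(** From [1 - x <= expR (- x)] one gets [expR x <= 1 / (1 - x)], and [(1 + x + 2 * x ^+ 2) * (1 - x)
    = 1 + x ^+ 2 * (1 - 2 * x)]. *)
Lemma expR_quadratic (R : realType) (x : R) : x <= 1 / 2 -> expR x <= 1 + x + 2 * x ^+ 2.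
Proof.
move=> x2; have p1 : 0 < 1 - x by lra.
have := expR_ge1Dx (- x); rewrite expRN => h.
have : expR x <= (1 - x)^-1.
  by rewrite -[expR x]invrK lef_pV2 ?posrE ?invr_gt0 ?expR_gt0.
move=> h'; apply: le_trans h' _; rewrite -div1r ler_pdivrMr //.
have := sqr_ge0 x; nra.
Qed.

(** This is [ln b <= b - 1]; it trades a [q]-th moment for an exponential moment. *)
Lemma powR_le_expR (R : realType) (b q : R) :
  0 <= b -> 0 < q -> b `^ q <= expR (q * (b - 1)).
Proof.
rewrite le_eqVlt => /orP[/eqP <-|b0] q0; first by rewrite powR0 ?expR_ge0 // gt_eqF.
rewrite /powR gt_eqF // ler_expR ler_pM2l //.
have := expR_ge1Dx (ln b); rewrite lnK ?posrE //; lra.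
Qed.

Lemma expR_norm_le (R : realType) (x : R) : expR `|x| <= expR x + expR (- x).
Proof.
case: (leP 0 x) => x0; first by rewrite ger0_norm // lerDl expR_ge0.
by rewrite ltr0_norm // lerDr expR_ge0.
Qed.

Section SmallCorrelation.
Variables (R : realType) (A : finType) (mu : A -> R) (J : Type) (r : seq J).
Variables (phi : J -> A -> R) (f : A -> R) (p eps : R).
Hypothesis mu_distr : is_distr mu.
Hypothesis p1 : 1 < p.
Hypothesis p2 : p <= 2.
Hypothesis eps0 : 0 < eps.
Hypothesis eps1 : eps <= 1.
Hypothesis f_mean : expect mu f = 0.
Hypothesis f_norm : Lpnorm mu p f = 1.
Hypothesis phi1 : forall j x, `|phi j x| <= 1.
Hypothesis phi_corr : forall j, eps ^+ 2 <= expect mu (fun x => f x * phi j x).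

Let ctr j x := phi j x - expect mu (phi j).

Hypothesis mgf_indep : forall sigma, `|sigma| <= 1 / 4 ->
  `|expect mu (fun x => \prod_(j <- r) expR (sigma * ctr j x))
    - \prod_(j <- r) expect mu (fun x => expR (sigma * ctr j x))| <= 1 / 2.

(** Since [ctr] is at most 2 in modulus, [sigma * ctr] is at most [1 / 2] and the quadratic bound
    applies; the linear term has mean 0 and the variance of [phi j] is at most 1. *)
Lemma centered_mgf j sigma : `|sigma| <= 1 / 4 ->
  expect mu (fun x => expR (sigma * ctr j x)) <= expR (2 * sigma ^+ 2).
Proof.
move=> s4; set m := expect mu (phi j).
have m1 : `|m| <= 1 by apply: ler_norm_expect.
apply: le_trans (_ : 1 + 2 * sigma ^+ 2 <= _); last by apply: expR_ge1Dx.
apply: le_trans (_ : expect mu (fun x =>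
    (1 + sigma * phi j x - sigma * m)
     + (2 * sigma ^+ 2) * (phi j x ^+ 2 - 2 * m * phi j x + m ^+ 2)) <= _).
  apply: ler_expect => // x.
  have -> : 1 + sigma * phi j x - sigma * m
     + 2 * sigma ^+ 2 * (phi j x ^+ 2 - 2 * m * phi j x + m ^+ 2)
     = 1 + sigma * ctr j x + 2 * (sigma * ctr j x) ^+ 2.
    by rewrite /ctr -/m; ring.
  apply: expR_quadratic; apply: le_trans (ler_norm _) _; rewrite normrM.
  have -> : 1 / 2 = (1 / 4) * 2 :> R by lra.
  apply: ler_pM => //; apply: le_trans (ler_normB _ _) _.
  by rewrite (_ : 2 = 1 + 1) ?lerD.
rewrite !(expectD, expectN, expectZ) !(expect_const mu_distr) -/m.
have : expect mu (fun x => phi j x ^+ 2) <= 1.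
  apply: expect_ler => // x; rewrite -real_normK ?num_real //.
  by rewrite expr_le1.
have s0 := sqr_ge0 sigma; have m0 := sqr_ge0 m.
move: (expect mu _) => E E1.
rewrite -subr_ge0 (_ : _ - _ = 2 * sigma ^+ 2 * (1 - E + m ^+ 2)); last by ring.
by rewrite (mulr_ge0 (mulr_ge0 _ s0)) //; lra.
Qed.

Let q := p / (p - 1).

Lemma correlated_family_bound : (size r)%:R <= 8 * q / eps ^+ 4.
Proof.
have pm : 0 < p - 1 by rewrite subr_gt0.
have p0 : 0 < p by apply: lt_trans p1.
have q2 : 2 <= q by rewrite /q ler_pdivlMr //; move: p2; lra.
have q0 : 0 < q by lra.
have conj : p^-1 + q^-1 = 1 by rewrite /q; field; rewrite !gt_eqF.
have eps40 : 0 < eps ^+ 4 by apply: exprn_gt0.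
rewrite leNgt; apply/negP => big.
set M : R := (size r)%:R in big *.
have M8 : 8 * q < M.
  apply: le_lt_trans big; rewrite ler_pdivlMr // ler_piMr //; first by lra.
  by rewrite exprn_ile1 // ltW.
have M0 : 0 < M by lra.
(* Chosen so that [M * (2 * lam ^+ 2) = q]: the product of the [M] moment generating functions at
   [lam] or [- lam] is at most [expR q]. The assumption to be refuted gives [M > 8 * q], hence
   [lam <= 1 / 4]. *)
pose lam := Num.sqrt (q / (2 * M)).
have lam2 : lam ^+ 2 = q / (2 * M) by rewrite sqr_sqrtr // divr_ge0 //; lra.
have lam0 : 0 < lam by rewrite sqrtr_gt0 divr_gt0 //; lra.
have lam4 : lam <= 1 / 4.
  rewrite -[leRHS]ger0_norm; last by lra.
  rewrite -sqrtr_sqr ler_wsqrtr // ler_pdivrMr; last by lra.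
  by rewrite (_ : (1 / 4) ^+ 2 * (2 * M) = M / 8); [lra|field].
(* The scale for Young's inequality: with [b = |Phi| / t] one has [q * b = lam * |Phi|], the
   exponent controlled by [mgf]. *)
pose t := q / lam.
have t0 : 0 < t by apply: divr_gt0.
have t2 : t ^+ 2 = 2 * q * M.
  by rewrite /t expr_div_n lam2; field; rewrite !gt_eqF.
pose Phi x := \sum_(j <- r) ctr j x.
have mgf sigma : `|sigma| = lam ->
    expect mu (fun x => expR (sigma * Phi x)) <= expR q + 1 / 2.
  move=> sl; have s4 : `|sigma| <= 1 / 4 by rewrite sl.
  rewrite (@eq_expect _ _ mu _ (fun x => \prod_(j <- r) expR (sigma * ctr j x)));
    last by move=> x; rewrite /Phi big_distrr /= expR_sum.
  have := mgf_indep s4; rewrite ler_norml => /andP[_ h].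
  have : \prod_(j <- r) expect mu (fun x => expR (sigma * ctr j x)) <= expR q.
    apply: le_trans (_ : \prod_(j <- r) expR (2 * sigma ^+ 2) <= _).
      apply: ler_prod => j _; rewrite centered_mgf // andbT.
      by apply: expect_ge0 => // x; apply: expR_ge0.
    rewrite -expR_sum ler_expR big_const_seq count_predT iter_addr_0 -[leLHS]mulr_natl.
    rewrite -/M -(real_normK (num_real sigma)) sl lam2 le_eqVlt; apply/orP; left.
    by apply/eqP; field; rewrite gt_eqF.
  by lra.
have fp : expect mu (fun x => `|f x| `^ p) = 1.
  have S0 : 0 <= \sum_a mu a * `|f a| `^ p.
    by apply: sumr_ge0 => a _; rewrite mulr_ge0 ?mu_distr.1 ?powR_ge0.
  move: f_norm; rewrite /Lpnorm => /(congr1 (fun u => u `^ p)).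
  by rewrite -powRrM mulVf ?gt_eqF // powRr1 // powR1.
have up : expect mu (fun x => f x * Phi x) <= 2 * t.
  pose b x := `|Phi x| / t.
  have b0 x : 0 <= b x by rewrite divr_ge0 // ltW.
  (* The bound is [expR (- q) * 2 * (expR q + 1 / 2) = 2 + expR (- q)]. *)
  have bq : expect mu (fun x => b x `^ q) <= 3.
    apply: le_trans (_ : expect mu (fun x =>
        expR (- q) * (expR (lam * Phi x) + expR (- lam * Phi x))) <= _).
      apply: ler_expect => // x; apply: le_trans (powR_le_expR (b0 x) q0) _.
      rewrite mulrBr mulr1 addrC expRD ler_pM2l ?expR_gt0 //.
      have -> : q * b x = `|lam * Phi x|.
        by rewrite normrM gtr0_norm // /b /t; field; rewrite !gt_eqF.
      by rewrite mulNr; apply: expR_norm_le.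
    rewrite expectZ expectD.
    have h1 := mgf lam (gtr0_norm lam0).
    have h2 : expect mu (fun x => expR (- lam * Phi x)) <= expR q + 1 / 2.
      by apply: mgf; rewrite normrN gtr0_norm.
    apply: le_trans (_ : expR (- q) * (expR q + 1 / 2 + (expR q + 1 / 2)) <= _).
      by rewrite ler_pM2l ?expR_gt0 // lerD.
    have e1 : expR (- q) * expR q = 1 by rewrite -expRD addNr expR0.
    have e2 : expR (- q) <= 1 by rewrite -expR0 ler_expR; lra.
    rewrite !mulrDr e1; lra.
  apply: le_trans (_ : expect mu (fun x =>
      t * (p^-1 * `|f x| `^ p + q^-1 * b x `^ q)) <= _).
    apply: ler_expect => // x; apply: le_trans (ler_norm _) _; rewrite normrM.
    have := conjugate_powR (normr_ge0 (f x)) (b0 x) p0 q0 conj.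
    rewrite -(ler_pM2l t0) => h.
    rewrite (_ : `|f x| * `|Phi x| = t * (`|f x| * b x)); last first.
      by rewrite /b; field; rewrite gt_eqF.
    by apply: le_trans h _; rewrite ler_pM2l // [p^-1 * _]mulrC [q^-1 * _]mulrC.
  rewrite expectZ expectD !expectZ fp mulr1 mulrC ler_pM2r //.
  (* The coefficient of [t] is at most [1 / p + 3 / q = 1 + 2 / q], and [p <= 2] makes [q >= 2]. *)
  have : q^-1 * expect mu (fun x => b x `^ q) <= q^-1 * 3.
    by rewrite ler_pM2l // invr_gt0.
  have : q^-1 <= 2^-1 by rewrite lef_pV2 ?posrE.
  by move: conj; lra.
(* Centering the [phi j] does not change their correlation with [f], as [f] has mean 0. *)
have low : M * eps ^+ 2 <= expect mu (fun x => f x * Phi x).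
  have -> : expect mu (fun x => f x * Phi x)
      = \sum_(j <- r) expect mu (fun x => f x * phi j x).
    rewrite (@eq_expect _ _ mu _ (fun x => \sum_(j <- r) f x * ctr j x)); last first.
      by move=> x; rewrite big_distrr.
    rewrite expect_sum; apply: eq_bigr => j _.
    rewrite (@eq_expect _ _ mu _ (fun x => f x * phi j x - expect mu (phi j) * f x)).
      by rewrite expectB expectZ f_mean mulr0 subr0.
    by move=> x; rewrite /ctr; ring.
  have -> : M * eps ^+ 2 = \sum_(j <- r) eps ^+ 2.
    by rewrite big_const_seq count_predT iter_addr_0 /M mulr_natl.
  by apply: ler_sum => j _; apply: phi_corr.
have : (M * eps ^+ 2) ^+ 2 <= (2 * t) ^+ 2.
  have a0 : 0 <= M * eps ^+ 2 by rewrite mulr_ge0 ?sqr_ge0 // ltW.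
  have b0 := le_trans low up.
  by rewrite ler_sqr ?nnegrE // (le_trans a0).
rewrite [(2 * t) ^+ 2]exprMn t2 [(M * _) ^+ 2]exprMn -exprM => h.
have : M * eps ^+ 4 <= 8 * q.
  rewrite -(ler_pM2l M0); move: h.
  rewrite (_ : M * (M * _) = M ^+ 2 * eps ^+ 4); last by ring.
  by rewrite (_ : 2 ^+ 2 * (2 * q * M) = M * (8 * q)) //; ring.
by rewrite -ler_pdivlMr // leNgt big.
Qed.

End SmallCorrelation.

(** * Blocks *)

Section Blocks.
Variables (n k : nat).

Definition block (j : nat) : {set 'I_n} :=
  [set x : 'I_n | (j * k <= x)%N && (x < j.+1 * k)%N].

Lemma block_interval j : is_int_interval (block j).
Proof.
move=> x y z; rewrite !inE => /andP[x1 _] /andP[_ z2] xy yz.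
by rewrite (leq_trans x1 xy) (leq_ltn_trans yz z2).
Qed.

Lemma card_block M j : (M * k <= n)%N -> (j < M)%N -> #|block j| = k.
Proof.
move=> room jM; have jk : (j * k + k <= n)%N.
  by apply: leq_trans room; rewrite addnC -mulSn leq_mul2r jM orbT.
have lt (i : 'I_k) : (j * k + i < n)%N.
  by apply: leq_trans jk; rewrite ltn_add2l.
have -> : block j = [set Ordinal (lt i) | i : 'I_k].
  apply/setP => x; rewrite inE mulSn; apply/andP/imsetP => [[x1 x2]|[i _ ->]] /=.
    have xk : (x - j * k < k)%N by rewrite ltn_subLR // addnC.
    by exists (Ordinal xk) => //; apply/val_inj; rewrite /= subnKC.
  by rewrite leq_addr addnC ltn_add2r.
rewrite card_imset ?card_ord // => i i' /(congr1 val) /= /addnI e.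
exact: val_inj.
Qed.

Lemma block_disjoint i j x : x \in block i -> x \in block j -> i = j.
Proof.
rewrite !inE => /andP[a b] /andP[c e].
have h u w : (u * k <= x)%N -> (x < w.+1 * k)%N -> (u <= w)%N.
  by move=> h1 h2; have := leq_ltn_trans h1 h2; rewrite ltn_mul2r => /andP[_].
by apply/eqP; rewrite eqn_leq (h _ _ a e) (h _ _ c b).
Qed.

Variable d : nat.
Hypothesis d0 : (0 < d)%N.

Definition block_sets (j : nat) : {set dsub n d} :=
  [set s : dsub n d | val s \subset block j].

Lemma block_sets_disjoint i j : i != j -> [disjoint block_sets i & block_sets j].
Proof.
move=> ij; apply/pred0P => s /=; rewrite !inE; apply/negbTE/negP.
move=> /andP[/fintype.subsetP si /fintype.subsetP sj].
have : (0 < #|val s|)%N by rewrite (eqP (valP s)).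
move=> /card_gt0P[x xs]; case/eqP: ij.
exact: block_disjoint (si _ xs) (sj _ xs).
Qed.

Lemma card_block_sets M j : (M * k <= n)%N -> (j < M)%N -> (#|block_sets j| <= k ^ d)%N.
Proof.
move=> room jM; rewrite -(card_imset _ val_inj).
apply: leq_trans (_ : #|[set s : {set 'I_n} | s \subset block j & #|s| == d]| <= _)%N.
  apply: subset_leq_card; apply/fintype.subsetP => _ /imsetP[s sj ->].
  by move: sj; rewrite !inE => ->; rewrite (valP s).
rewrite cards_draws (card_block room jM).
apply: leq_trans (_ : k ^_ d <= _)%N.
  by rewrite -bin_ffact leq_pmulr ?fact_gt0.
have h e : (k ^_ e <= k ^ e)%N.
  by elim: e => // e IH; rewrite ffactnSr expnSr leq_mul // leq_subr.
exact: h.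
Qed.

End Blocks.

Section FewBadBlocks.
Variables (R : realType) (n d k M : nat) (T : finType) (mu : array n d T -> R).
Variables (eta : R) (B N : nat) (z p eps : R) (S : {set T}) (f : array n d T -> R).
Hypothesis mu_distr : is_distr mu.
Hypothesis eta0 : 0 <= eta.
Hypothesis spr : spreadable mu eta.
Hypothesis N0 : (0 < N)%N.
Hypothesis room : (B * N <= n)%N.
Hypothesis MkB : (M * k + d + d <= B)%N.
Hypothesis z01 : 0 <= z <= 1.
Hypothesis z_dom : 2 ^+ (d + 2) * (2 * eta + N%:R^-1) <= z ^+ (2 ^ (2 * d)).
Hypothesis d0 : (0 < d)%N.
Hypothesis M0 : (0 < M)%N.
Hypothesis T0 : (0 < #|T|)%N.
Hypothesis cardS : #|S| = (#|T| - 1)%N.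
Hypothesis box_indep : forall a, a \in S ->
  `| prob mu (fun x => [forall s in Box n d, x s == a])
     - \prod_(s in Box n d) prob mu (fun x => x s == a) | <= eta.
Hypothesis err_small : M%:R * (2 ^+ M * ((#|T| ^ (M * k ^ d))%:R
  * (2 * (M * k ^ d)%:R * (#|T|%:R * (16 * z))))) <= 1 / 2.
Hypothesis p1 : 1 < p.
Hypothesis p2 : p <= 2.
Hypothesis eps0 : 0 < eps.
Hypothesis eps1 : eps <= 1.
Hypothesis f_mean : expect mu f = 0.
Hypothesis f_norm : Lpnorm mu p f = 1.

Definition bad_block (j : 'I_M) : bool :=
  [exists J : {set 'I_n}, [&& J \subset block n k j, (d <= #|J|)%N &
     prob mu (fun x => `|condexp mu f J x| <= eps) < 1 - eps]].

Let Bn : (B <= n)%N. Proof. by apply: leq_trans room; apply: leq_pmulr. Qed.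
Let Mkn : (M * k <= n)%N.
Proof. by apply: leq_trans Bn; apply: leq_trans MkB; rewrite -addnA leq_addr. Qed.
Let ddB : (d + d <= B)%N. Proof. by apply: leq_trans MkB; rewrite -addnA leq_addl. Qed.

Let F0 : {set dsub n d} := \bigcup_(j : 'I_M) block_sets n k d j.
Let U : {set 'I_n} := [set x : 'I_n | (x < M * k)%N].

Let cardF0 : (#|F0| <= M * k ^ d)%N.
Proof.
apply: leq_trans (_ : \sum_(j < M) k ^ d <= _)%N; last by rewrite sum_nat_const card_ord.
apply: leq_trans (_ : \sum_(j < M) #|block_sets n k d j| <= _)%N; last first.
  by apply: leq_sum => j _; apply: (@card_block_sets n k d M j Mkn).
rewrite /F0; elim/big_rec2: _ => [|j A1 A2 _ h]; first by rewrite cards0.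
by apply: leq_trans (leq_card_setU _ _) _; rewrite leq_add2l.
Qed.

Let cardU : (#|U| + d <= B)%N.
Proof.
apply: leq_trans MkB; rewrite -addnA; apply: leq_add; last exact: leq_addr.
have -> : U = [set x in [seq widen_ord Mkn i | i : 'I_(M * k)]].
  apply/setP => x; rewrite !inE; apply/idP/mapP => [h|[i _ ->]] /=; last exact: ltn_ord.
  by exists (Ordinal h); rewrite ?mem_enum //; apply/val_inj.
by rewrite cardsE; apply: leq_trans (card_size _) _; rewrite size_image card_ord.
Qed.

Let F0U s : s \in F0 -> val s \subset U.
Proof.
move=> /bigcupP[j _]; rewrite inE => sj; apply: fintype.subset_trans sj _.
apply/fintype.subsetP => x; rewrite !inE => /andP[_ h]; apply: leq_trans h _.
by rewrite leq_mul2r ltn_ord orbT.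
Qed.

(** The exponentials of the centered witnesses depend on disjoint sets of entries, so
    [approx_indep_prod] with [K = 2] supplies the approximate factorisation that
    [correlated_family_bound] asks for; [err_small] is its error bound with all sizes at their
    maximum. *)
Lemma few_bad_blocks : #|[set j | bad_block j]|%:R <= 8 * (p / (p - 1)) / eps ^+ 4.
Proof.
have [t0 _] := card_gt0P T0.
have s0 : dsub n d.
  have dn : (d <= n)%N by apply: leq_trans Bn; apply: leq_trans ddB; apply: leq_addr.
  have c : #|[set widen_ord dn i | i : 'I_d]| == d.
    by rewrite card_imset ?card_ord // => i i' /(congr1 val) /= /val_inj.
  exact: (exist (fun s : {set 'I_n} => is_true (#|s| == d)) _ c).
(* Indexing by the subtype gives every index a witness [phi], and its enumeration has as many terms
   as there are bad blocks. *)
pose BJ : finType := {j : 'I_M | bad_block j}.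
pose r := enum BJ.
have sz : size r = #|[set j | bad_block j]|.
  by rewrite /r -cardE card_sig; apply: eq_card => j; rewrite inE.
rewrite -sz.
have ex (b : BJ) : exists phi : array n d T -> R,
    [/\ depends_on (block_sets n k d (val b)) phi, forall x, `|phi x| <= 1
      & eps ^+ 2 <= expect mu (fun x => f x * phi x)].
  have /existsP[J /and3P[Jb _ small]] := valP b.
  have [phi [ph1 ph2 ph3]] := condexp_witness mu_distr eps0 small.
  exists phi; split=> // x x' xx; apply: ph1 => s; rewrite inE => sJ; apply: xx.
  by rewrite inE; apply: fintype.subset_trans Jb.
have [phi phiP] := boolp.choice ex.
have phi_dep (b : BJ) : depends_on (block_sets n k d (val b)) (phi b) by case: (phiP b).
have phi1 (b : BJ) x : `|phi b x| <= 1 by case: (phiP b).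
have phi_corr (b : BJ) : eps ^+ 2 <= expect mu (fun x => f x * phi b x) by case: (phiP b).
apply: (correlated_family_bound mu_distr p1 p2 eps0 eps1 f_mean f_norm phi1 phi_corr).
move=> sigma s4; have /andP[z0 z1] := z01.
have e0 : 0 <= #|T|%:R * (16 * z) by rewrite mulr_ge0 ?mulr_ge0.
have iid (q : seq (dsub n d)) (y : array n d T) : uniq q -> {subset q <= F0} ->
  `|prob mu (fun x => all (fun s => x s == y s) q)
     - \prod_(s <- q) marginal mu s0 (y s)| <= (size q)%:R * (#|T|%:R * (16 * z)).
  move=> uq qF; apply: (entries_nearly_iid s0 mu_distr eta0 spr N0 room ddB z01
    z_dom T0 cardS box_indep y uq _ cardU).
  by move=> s /qF; apply: F0U.
have m01 a : 0 <= marginal mu s0 a <= 1 by apply: prob01.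
have dis (b b' : BJ) : b != b' ->
    [disjoint block_sets n k d (val b) & block_sets n k d (val b')].
  by move=> bb; apply: block_sets_disjoint => //; rewrite !(inj_eq val_inj).
have subF (b : BJ) : block_sets n k d (val b) \subset F0.
  exact: (finset.bigcup_sup (val b)).
have Z_dep (b : BJ) : depends_on (block_sets n k d (val b))
    (fun x => expR (sigma * (phi b x - expect mu (phi b)))).
  by move=> x x' xx; rewrite (phi_dep b _ _ xx).
have Z2 (b : BJ) x : `|expR (sigma * (phi b x - expect mu (phi b)))| <= 2.
  rewrite ger0_norm ?expR_ge0 //.
  have m1 : `|expect mu (phi b)| <= 1 by apply: ler_norm_expect.
  apply: le_trans (_ : expR (1 / 2) <= _); last first.
    by apply: le_trans (expR_quadratic (lexx _)) _; lra.
  rewrite ler_expR; apply: le_trans (ler_norm _) _; rewrite normrM.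
  have -> : 1 / 2 = (1 / 4) * 2 :> R by lra.
  apply: ler_pM => //; apply: le_trans (ler_normB _ _) _.
  by rewrite (_ : 2 = 1 + 1) ?lerD.
have one2 : 1 <= 2 :> R by rewrite ler1n.
have h := approx_indep_prod t0 mu_distr m01 e0 iid (enum_uniq BJ) dis subF Z_dep one2 Z2.
apply: le_trans h _; apply: le_trans err_small.
have rM : (size r <= M)%N.
  by rewrite sz; apply: leq_trans (max_card _) _; rewrite card_ord.
have tw j : 0 <= 2 ^+ j :> R by apply: exprn_ge0.
apply: ler_pM => //; first by rewrite !mulr_ge0.
  by rewrite ler_nat.
apply: ler_pM => //; first by rewrite !mulr_ge0.
  by rewrite ler_weXn2l.
apply: ler_pM => //; first by rewrite !mulr_ge0.
  by rewrite ler_nat leq_pexp2l.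
by rewrite ler_wpM2r // ler_wpM2l // ler_nat.
Qed.

End FewBadBlocks.

(** * Choice of the parameters *)

Section Numerics.
Variables (d m k M : nat).
Hypothesis d0 : (0 < d)%N.
Hypothesis m2 : (2 <= m)%N.
Hypothesis dk : (d <= k)%N.
Hypothesis M0 : (0 < M)%N.

Let F := (M * k ^ d)%N.
Let k0 : (0 < k)%N. Proof. exact: leq_trans dk. Qed.
Let kF : (M * k <= F)%N.
Proof. by rewrite leq_mul2l -[X in (X <= _)%N]expn1 leq_pexp2l // orbT. Qed.
Let MF : (M <= F)%N.
Proof. by apply: leq_pmulr; rewrite expn_gt0 k0. Qed.
Let dF : (d <= F)%N.
Proof. by apply: leq_trans dk _; apply: leq_trans kF; apply: leq_pmull. Qed.
Let F1 : (0 < F)%N. Proof. exact: leq_trans dF. Qed.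
Let pow2 j : (2 ^ j <= m ^ j)%N. Proof. by case: j => // j; rewrite leq_exp2r. Qed.
Let le_pow j : (j <= m ^ j)%N.
Proof. by apply: leq_trans (pow2 j); apply/ltnW/ltn_expl. Qed.
Let pow_le i j : (i <= j)%N -> (m ^ i <= m ^ j)%N.
Proof. by move=> ij; rewrite leq_pexp2l // (leq_trans _ m2). Qed.

(** The factor [2 ^ (d + 4) * (M * k + d + d)] is at most [m ^ (8 * F)], and [8 <= 2 * 4 ^ d] turns
    [11] into [13]. *)
Lemma room_bound :
  (2 ^ (d + 4) * (M * k + d + d) * m ^ (11 * F * 4 ^ d) <= m ^ (13 * 4 ^ d * F))%N.
Proof.
have B4 : (M * k + d + d <= 2 ^ 2 * F)%N by move: kF dF; lia.
have h : (2 ^ (d + 4) * (M * k + d + d) <= m ^ (8 * F))%N.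
  apply: leq_trans (_ : m ^ (d + 4) * (m ^ 2 * m ^ F) <= _)%N.
    apply: leq_mul; first exact: pow2.
    by apply: leq_trans B4 _; apply: leq_mul; [exact: pow2|exact: le_pow].
  by rewrite -!expnD; apply: pow_le; move: dF F1; lia.
apply: leq_trans (leq_mul h (leqnn _)) _; rewrite -expnD; apply: pow_le.
have : (4 <= 4 ^ d)%N by rewrite -[X in (X <= _)%N]expn1 leq_pexp2l.
by move: (4 ^ d)%N => X; nia.
Qed.

(** Each factor is at most a power of [m ^ F]: six for [64] and one for each of the other five,
    hence the exponent [11 * F], which fixes the size of [z] later. *)
Lemma total_error_bound :
  (64 * (M * (2 ^ M * (m ^ F * (F * m)))) <= m ^ (11 * F))%N.
Proof.
apply: leq_trans (_ : m ^ (6 * F) * (m ^ F * (m ^ F * (m ^ F * (m ^ F * m ^ F)))) <= _)%N;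
  last by rewrite -!expnD; apply: pow_le; lia.
apply: leq_mul.
  by apply: leq_trans (pow2 6) _; apply: pow_le; move: F1; lia.
apply: leq_mul; first by apply: leq_trans (le_pow M) (pow_le MF).
apply: leq_mul; first by apply: leq_trans (pow2 M) (pow_le MF).
apply: leq_mul => //; apply: leq_mul; first exact: le_pow.
by rewrite -[X in (X <= _)%N]expn1; apply: pow_le.
Qed.

(** After cancelling [ln m] and [k ^ d], the claim is that [13 * 4 ^ d * M] times the denominator
    [del] is at most [24 * d]. Since [del] is at most [eps ^+ 12 * (p - 1) / 256 ^ d], the product
    is at most [221 * eps ^+ 7 / 64 ^ d], which is below 4. *)
Lemma exponent_bound (R : realType) (p eps : R) :
  1 < p -> p <= 2 -> 0 < eps -> eps <= 1 ->
  M%:R <= 17 / ((p - 1) * eps ^+ 5) ->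
  m%:R ^+ (13 * 4 ^ d * F)
  <= expR ((24 * d%:R * ln m%:R) /
           ((eps ^+ 3 / 4) ^+ (4 * d) * (p - 1) ^+ d) * k%:R ^+ d).
Proof.
move=> p1 p2 e0 e1 Mb.
have m0 : 0 < m%:R :> R by rewrite ltr0n (leq_trans _ m2).
have ln0 : 0 <= ln (m%:R : R) by rewrite ln_ge0 // ler1n (leq_trans _ m2).
have pm : 0 < p - 1 by lra.
rewrite -[leLHS]lnK ?posrE ?exprn_gt0 // ler_expR lnXn // -[leLHS]mulr_natl.
set del := _ * (p - 1) ^+ d.
have del0 : 0 < del by rewrite mulr_gt0 ?exprn_gt0 ?divr_gt0 ?exprn_gt0.
have -> : 24 * d%:R * ln m%:R / del * k%:R ^+ d
    = 24 * d%:R / del * k%:R ^+ d * ln m%:R :> R by field; rewrite gt_eqF.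
rewrite ler_wpM2r // /F !natrM !natrX mulrA ler_wpM2r ?exprn_ge0 //.
rewrite ler_pdivlMr //.
pose w := eps ^+ 12 * (p - 1); pose c : R := 4 ^+ 4.
have c0 : 0 < c by rewrite exprn_gt0.
have c4 : 4 / c = 64^-1 by rewrite /c; field.
have w0 : 0 < w by rewrite mulr_gt0 ?exprn_gt0.
have w1 : w <= 1.
  by apply: mulr_ile1; [exact/ltW/exprn_gt0|exact: ltW|rewrite exprn_ile1 // ltW|lra].
have delE : del = w ^+ d / c ^+ d.
  rewrite /del exprM -exprMn /w -expr_div_n; congr (_ ^+ d).
  by rewrite /c; field.
have wd : w ^+ d <= w by rewrite -[leRHS]expr1 ler_wiXn2l // ltW.
have del_le : del <= w / c ^+ d by rewrite delE ler_pM2r ?invr_gt0 ?exprn_gt0.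
have X0 : 0 < 4 ^+ d :> R by rewrite exprn_gt0.
apply: le_trans (_ : 13 * 4 ^+ d * (17 / ((p - 1) * eps ^+ 5)) * (w / c ^+ d) <= _).
  have hM : 13 * 4 ^+ d * M%:R <= 13 * 4 ^+ d * (17 / ((p - 1) * eps ^+ 5)).
    by rewrite ler_pM2l // mulr_gt0.
  have h0 : 0 <= 13 * 4 ^+ d * M%:R :> R by rewrite mulr_ge0 // mulr_ge0 // ltW.
  exact: ler_pM h0 (ltW del0) hM del_le.
have -> : 13 * 4 ^+ d * (17 / ((p - 1) * eps ^+ 5)) * (w / c ^+ d)
    = 221 * eps ^+ 7 * (4 ^+ d / c ^+ d).
  by rewrite /w; field; rewrite !gt_eqF ?exprn_gt0.
rewrite -expr_div_n c4.
have h7 : eps ^+ 7 <= 1 by rewrite exprn_ile1 // ltW.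
have h70 : 0 <= eps ^+ 7 by rewrite exprn_ge0 // ltW.
have hd : (64^-1) ^+ d <= 64^-1 :> R.
  have u1 : 64^-1 <= 1 :> R by rewrite invf_le1 // ler1n.
  have u0 : 0 <= 64^-1 :> R by rewrite invr_ge0.
  by have := ler_wiXn2l u0 u1 d0; rewrite expr1.
have hd0 : 0 <= (64^-1) ^+ d :> R by rewrite exprn_ge0 // invr_ge0.
have : eps ^+ 7 * 64^-1 ^+ d <= 64^-1 by apply: le_trans hd; rewrite ler_piMl.
rewrite -mulrA; move: (eps ^+ 7 * _) => X.
have : 1 <= d%:R :> R by rewrite ler1n.
by lra.
Qed.

End Numerics.

(** Double counting: the bad masses of the [M] indices add up to at most [M * eps], so they cannot
    all exceed [eps]. *)
Lemma exists_light_index (R : realType) (V : finType) (lam : V -> R) (M : nat)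
    (bad : V -> 'I_M -> bool) (eps : R) :
  (0 < M)%N -> is_distr lam ->
  (forall v, #|[set j | bad v j]|%:R <= M%:R * eps) ->
  exists j, \sum_(v | bad v j) lam v <= eps.
Proof.
move=> M0 lamd few.
case: (boolP [exists j : 'I_M, \sum_(v | bad v j) lam v <= eps]) => [/existsP //|].
rewrite negb_exists => /forallP heavy; exfalso.
have tot : \sum_(j < M) \sum_(v | bad v j) lam v <= M%:R * eps.
  rewrite (exchange_big_dep predT) //=.
  rewrite -[leRHS](expect_const lamd) /expect; apply: ler_sum => v _.
  rewrite (eq_bigl (fun j => j \in [set j | bad v j])) => [|j]; last by rewrite inE.
  by rewrite sumr_const -[leLHS]mulr_natr ler_wpM2l ?lamd.1.
have : M%:R * eps < \sum_(j < M) \sum_(v | bad v j) lam v.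
  rewrite -[X in X * _](_ : (\sum_(j < M) 1) = _); last by rewrite sumr_const card_ord.
  rewrite mulr_suml; apply: ltr_sum => [|j _]; first by apply/hasP; exists (Ordinal M0).
  by rewrite mul1r ltNge heavy.
by rewrite ltNge tot.
Qed.

Theorem theorem7p4 (R : realType) (d m : nat) (p eps : R) (k n : nat)
  (V : finType) (lam : V -> R)
  (T : V -> finType)
  (mu : forall v : V, array n d (T v) -> R)
  (f : forall v : V, array n d (T v) -> R) :
  (0 < d)%N -> (2 <= m)%N ->
  1 < p -> p <= 2 ->
  0 < eps -> eps <= 1 ->
  (d <= k)%N ->
  let C' := expR ((24 * d%:R * ln m%:R) /
                  ((eps ^+ 3 / 4) ^+ (4 * d) * (p - 1) ^+ d) * k%:R ^+ d) in
  C' <= n%:R ->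
  is_distr lam ->
  (forall v, #|T v| = m) ->
  (forall v, is_distr (mu v)) ->
  (forall v, spreadable (mu v) C'^-1) ->
  (forall v, exists S : {set T v}, #|S| = (#|T v| - 1)%N /\
     forall a, a \in S ->
       `| prob (mu v) (fun x => [forall s in Box n d, x s == a])
          - \prod_(s in Box n d) prob (mu v) (fun x => x s == a) | <= C'^-1) ->
  (forall v, expect (mu v) (f v) = 0) ->
  (forall v, Lpnorm (mu v) p (f v) = 1) ->
  exists (G : {set V}) (I : {set 'I_n}),
    \sum_(v in G) lam v >= 1 - eps /\
    is_int_interval I /\ #|I| = k /\
    forall v, v \in G -> forall J : {set 'I_n}, J \subset I -> (d <= #|J|)%N ->
      prob (mu v) (fun x => `| condexp (mu v) (f v) J x | <= eps) >= 1 - eps.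
Proof.
move=> d0 m2 p1 p2 e0 e1 dk C' Cn lamd cardT mud spr Sv f0 fp.
have pm : 0 < p - 1 by rewrite subr_gt0.
have e50 : 0 < (p - 1) * eps ^+ 5 by rewrite mulr_gt0 ?exprn_gt0.
have e51 : (p - 1) * eps ^+ 5 <= 1.
  by apply: mulr_ile1; [exact: ltW|exact/ltW/exprn_gt0|lra|rewrite exprn_ile1 // ltW].
(* As [q <= 2 / (p - 1)], the bound [8 * q / eps ^ 4] is at most [eps * 16 / ((p - 1) * eps ^ 5)],
   hence at most [eps * M]. Rounding up costs at most 1, which turns 16 into 17. *)
pose M := (Num.truncn (16 / ((p - 1) * eps ^+ 5))).+1.
have M0 : (0 < M)%N by [].
have Mlow : 16 / ((p - 1) * eps ^+ 5) <= M%:R by apply/ltW/truncnS_gt.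
have Mup : M%:R <= 17 / ((p - 1) * eps ^+ 5).
  have h0 : 0 <= 16 / ((p - 1) * eps ^+ 5) by rewrite divr_ge0 // ltW.
  have /andP[h _] := truncn_itv h0.
  have : 1 <= 1 / ((p - 1) * eps ^+ 5) by rewrite ler_pdivlMr // mul1r.
  rewrite /M -natr1; move: h; rewrite !mulrDl; set X := ((p - 1) * eps ^+ 5)^-1; lra.
have Cbig := exponent_bound k d0 m2 p1 p2 e0 e1 Mup; rewrite -/C' in Cbig.
have := room_bound d0 m2 dk M0; have := total_error_bound d0 m2 dk M0.
set F := (M * k ^ d)%N; set B := (M * k + d + d)%N => errb roomb.
have C0 : 0 < C' by apply: expR_gt0.
have B0 : (0 < B)%N by rewrite /B addn_gt0 d0 orbT.
have m0 : (0 < m)%N by apply: leq_trans m2.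
have BC : 2 ^+ (d + 4) * B%:R * m%:R ^+ (11 * F * 4 ^ d) <= C'.
  by apply: le_trans Cbig; rewrite -!natrX -!natrM ler_nat.
have Bn : (B <= n)%N.
  rewrite -(ler_nat R); apply: le_trans Cn; apply: le_trans BC.
  rewrite -!natrX -!natrM ler_nat mulnAC; apply: leq_pmull.
  by rewrite muln_gt0 !expn_gt0 m0.
(* The largest stretching factor that [B] vertices allow; it gives
   [1 / N <= 2 * B / n <= 2 * B / C']. *)
pose N := (n %/ B)%N.
have N0 : (0 < N)%N by rewrite divn_gt0.
have room : (B * N <= n)%N by rewrite mulnC leq_divM.
have nN : (n <= 2 * B * N)%N.
  apply: leq_trans (ltnW (ltn_ceil n B0)) _; rewrite -/N.
  by rewrite mulnC -mulnA mulnCA leq_mul2l mul2n -addnn -addn1 leq_add2l N0 orbT.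
have NC : N%:R^-1 <= 2 * B%:R / C'.
  rewrite ler_pdivlMr // ler_pdivrMl ?ltr0n //; apply: le_trans Cn _.
  by rewrite -!natrM ler_nat mulnC.
(* Small enough for [total_error_bound] to give the total error [1 / 2], yet large enough, by
   [room_bound], for its [4 ^ d]-th power to dominate the initial error of order [B / C']. *)
pose z : R := (m%:R ^+ (11 * F))^-1.
have mQ : 1 <= m%:R ^+ (11 * F) :> R by apply: exprn_ege1; rewrite ler1n.
have mQ0 : 0 < m%:R ^+ (11 * F) :> R by apply: lt_le_trans mQ.
have z01 : 0 <= z <= 1 by rewrite /z invr_ge0 ltW //= invf_le1.
have z_dom : 2 ^+ (d + 2) * (2 * C'^-1 + N%:R^-1) <= z ^+ (2 ^ (2 * d)).
  rewrite /z exprVn -exprM expnM (_ : 2 ^ 2 = 4)%N //.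
  set P0 := m%:R ^+ _; have P00 : 0 < P0 :> R by rewrite exprn_gt0 // ltr0n.
  have D0 : 0 < 2 ^+ (d + 2) :> R by rewrite exprn_gt0.
  apply: le_trans (_ : 2 ^+ (d + 2) * (2 * C'^-1 + 2 * B%:R / C') <= _).
    by rewrite ler_pM2l // lerD2l.
  rewrite -[leRHS]mul1r ler_pdivlMr //.
  have B1 : 1 <= B%:R :> R by rewrite ler1n.
  apply: le_trans (_ : 2 ^+ (d + 4) * B%:R * P0 / C' <= _); last first.
    by rewrite ler_pdivrMr // mul1r.
  have -> : 2 ^+ (d + 2) * (2 / C' + 2 * B%:R / C') * P0
      = 2 ^+ (d + 2) * (2 + 2 * B%:R) * P0 / C' by field; rewrite gt_eqF.
  rewrite ler_pM2r ?invr_gt0 // ler_pM2r //.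
  have -> : 2 ^+ (d + 4) * B%:R = 2 ^+ (d + 2) * (4 * B%:R) :> R.
    by rewrite (_ : d + 4 = d + 2 + 2)%N ?exprD; [ring|rewrite -addnA].
  by rewrite ler_pM2l //; lra.
have few v : #|[set j : 'I_M | bad_block k (mu v) eps (f v) j]|%:R <= M%:R * eps.
  have [S [cardS Sbox]] := Sv v.
  have err_small : M%:R * (2 ^+ M * ((#|T v| ^ (M * k ^ d))%:R
      * (2 * (M * k ^ d)%:R * (#|T v|%:R * (16 * z))))) <= 1 / 2.
    rewrite cardT -/F.
    have h : (64 * (M * (2 ^ M * (m ^ F * (F * m)))))%:R <= m%:R ^+ (11 * F) :> R.
      by rewrite -natrX ler_nat.
    rewrite (_ : M%:R * _ = (64 * (M * (2 ^ M * (m ^ F * (F * m)))))%:R / 2 * z).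
      by rewrite /z ler_pdivrMr //; lra.
    by rewrite !natrM !natrX; field.
  have T0 : (0 < #|T v|)%N by rewrite cardT.
  have Ci0 : 0 <= C'^-1 by rewrite invr_ge0 ltW.
  have := few_bad_blocks (mud v) Ci0 (spr v) N0 room (leqnn _) z01 z_dom d0 T0
    cardS Sbox err_small p1 p2 e0 e1 (f0 v) (fp v).
  move=> h; apply: le_trans h _.
  apply: le_trans (_ : 16 / ((p - 1) * eps ^+ 5) * eps <= _); last by rewrite ler_pM2r.
  have -> : 16 / ((p - 1) * eps ^+ 5) * eps = 16 / (p - 1) / eps ^+ 4.
    by field; rewrite !gt_eqF.
  rewrite ler_pM2r ?invr_gt0 ?exprn_gt0 // mulrA ler_pM2r ?invr_gt0 //; lra.
have [j light] := exists_light_index M0 lamd few.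
have Mkn : (M * k <= n)%N.
  by apply: leq_trans Bn; rewrite /B -addnA leq_addr.
exists [set v | ~~ bad_block k (mu v) eps (f v) j], (block n k j); split.
  have tot : 1 = \sum_(v | bad_block k (mu v) eps (f v) j) lam v
      + \sum_(v in [set v | ~~ bad_block k (mu v) eps (f v) j]) lam v.
    rewrite -(lamd.2) (bigID (fun v => bad_block k (mu v) eps (f v) j)) /=.
    by congr (_ + _); apply: eq_bigl => v; rewrite inE.
  by rewrite tot lerBlDr addrC lerD2l.
split; first exact: block_interval.
split; first exact: (card_block Mkn).
move=> v; rewrite inE negb_exists => /forallP good J JI dJ.
by have := good J; rewrite JI dJ /= -leNgt.
Qed.
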